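(* Fix $F>0$, $E\in\mathbb{R}$, $\alpha\ge0$, $\beta>0$, $\mu>0$, $C>0$, and let $h:\mathbb{N}\to\mathbb{R}$ satisfy $|h(n+1)-h(n)|\le Cn^{-\beta}$ for all integers $n\in[x_l,x_{l+1}]$. Then for all sufficiently large $l$ and all $x_l\le a<b\le x_{l+1}$, $$\Bigl|\sum_{a<n\le b}\frac{e^{i(\mu\gamma(n)+h(n))}}{\gamma'(n)^\alpha}\Bigr|\lesssim l^{-\alpha+1/2}\bigl(1+l^{1-2\beta}\bigr),$$ with implicit constant uniform for $E,F,\alpha,\beta,\mu,C$ in compact subsets of their domains.
   Context: The reference solution is $\zeta(x)=(\pi/F^{1/3})^{1/2}\bigl(i\,\mathrm{Ai}(-F^{1/3}(x+E/F))+\mathrm{Bi}(-F^{1/3}(x+E/F))\bigr)$ (Airy functions); it has no real zeros and $\gamma\in C^\infty(\mathbb{R})$ is the real function with $\zeta=|\zeta|e^{i\gamma}$, $\gamma(0)\in(-\pi,\pi]$. For $l\in\mathbb{N}$, $x_l=\bigl\lceil\frac{\pi^2}{F}(l-\frac12)^2\bigr\rceil-\frac12$; sums are over integers $n$. *)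

(* Defs.v *)
From Stdlib Require Import Reals ZArith.
From Coquelicot Require Import Coquelicot.
Open Scope R_scope.

(* Airy functions via their standard integral representations (DLMF 9.5.1, 9.5.4):
   Ai(x) = (1/pi) int_0^oo cos(t^3/3 + x t) dt,
   Bi(x) = (1/pi) int_0^oo [exp(-t^3/3 + x t) + sin(t^3/3 + x t)] dt,
   the improper integrals being limits of RInt over [0,T] as T -> +oo. *)
Definition Ai (x : R) : R :=
  / PI * real (Lim (fun T => RInt (fun t => cos (t ^ 3 / 3 + x * t)) 0 T) p_infty).
Definition Bi (x : R) : R :=
  / PI * real (Lim (fun T => RInt (fun t => exp (- (t ^ 3) / 3 + x * t)
                                          + sin (t ^ 3 / 3 + x * t)) 0 T) p_infty).

Definition cbrtF (F : R) : R := Rpower F (1 / 3).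
Definition zeta (F E x : R) : C :=
  let u := - (cbrtF F * (x + E / F)) in
  Cmult (RtoC (sqrt (PI / cbrtF F))) (Bi u, Ai u).

Definition is_phase_of_zeta (F E : R) (g : R -> R) : Prop :=
  (forall x, continuous g x) /\
  (forall x, zeta F E x = Cmult (RtoC (Cmod (zeta F E x))) (cos (g x), sin (g x))) /\
  - PI < g 0 <= PI.

Definition Rceil (x : R) : Z := (1 - up (- x))%Z.

Definition xl (F : R) (l : nat) : R :=
  IZR (Rceil (PI ^ 2 / F * (INR l - 1 / 2) ^ 2)) - 1 / 2.

Definition summand (g : R -> R) (h : nat -> R) (mu alpha : R) (n : nat) : C :=
  let th := mu * g (INR n) + h n in
  let w := Rpower (Derive g (INR n)) alpha in
  (cos th / w, sin th / w).

(* sum over the integers n with a < n <= b (these are nonnegative when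
   a >= 0, and all of them are <= Z.to_nat (up b)) *)
Definition window_sum (g : R -> R) (h : nat -> R) (mu alpha a b : R) : C :=
  sum_n (fun n : nat =>
           if Rlt_dec a (INR n) then
             if Rle_dec (INR n) b then summand g h mu alpha n else zero
           else zero)
        (Z.to_nat (up b)).

(* Main.v *)
Require Import Defs.
From Stdlib Require Import Reals ZArith Lra Lia.
From Coquelicot Require Import Coquelicot.
Open Scope R_scope.

(* Idea.  Substituting [z = s^4] and moving the contour of the Airy integrals to the line of
   slope [pi/6] through the saddle point [- i s^2] gives the exact formula
     Bi(- s^4) + i Ai(- s^4) = (2 / (pi s)) exp (i (pi/6 + 2 s^6 / 3)) K(s^(-3)),
   where [K(e)] is the integral over [r > 0] of [exp (- a r^2 + i r^2/2) cos (e r^3/3)] with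
   [a = sqrt 3 / 2].  [K] is smooth with [Re K > 0] near [0], so [gamma] equals
   [2 s^6 / 3] plus a smooth function of [s^(-3)], up to a constant.  With [Y = sqrt (F x + E)]
   this makes [gamma'] comparable to [Y] and [gamma''] to [F / Y], and [Y] is comparable to [l]
   on the window.  The second derivative test of van der Corput bounds the sums of
   [exp (i mu gamma(n))] by a multiple of [sqrt l], and a summation by parts puts back the
   weights [exp (i h(n)) / gamma'(n)^alpha], whose total variation is at most
   [l^(- alpha) (1 + l^(1 - 2 beta))] up to a constant. *)

(** * Absolutely convergent improper integrals *)

(** Bounds on [gamma''] cannot be read off asymptotic expansions of [Ai] and [Bi], since these may
    not be differentiated term by term. The exact formula can be differentiated, because its
    remaining factor [K] is smooth up to [e = 0], the image of [z] at infinity. This dictates the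
    slope of the line. With [w] the displacement from the saddle point, the exponent is a constant
    plus [i s^2 w^2 - w^3/3]. Along [exp (i pi/6)] the cube [w^3] is purely imaginary, so the cubic
    term only oscillates and the Gaussian factor does not involve [e]. Along the steepest direction
    [exp (i pi/4)] the cubic term would grow on one half of the line. Uniformity comes from
    absorption: the corrections to the leading terms of [gamma'] and [gamma''] vanish relative to
    them, so beyond a threshold that may depend on all the data they are covered by absolute
    numerical factors. The final constant then depends only on the ranges of the parameters. *)

Lemma increment_le (phi psi d e : R -> R) (a b : R) :
  a <= b ->
  (forall x, a <= x <= b -> is_derive phi x (d x)) ->
  (forall x, a <= x <= b -> is_derive psi x (e x)) ->
  (forall x, a <= x <= b -> Rabs (d x) <= e x) ->
  Rabs (phi b - phi a) <= psi b - psi a.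
Proof.
  intros Hab Hphi Hpsi Hde.
  (* The two signs give the two halves of the absolute value; each is the mean value theorem for
     [psi - s * phi], whose derivative is nonnegative. *)
  assert (Hs : forall s, s = 1 \/ s = -1 -> s * (phi b - phi a) <= psi b - psi a).
  { intros s Hs.
    destruct (MVT_gen (fun x => psi x - s * phi x) a b (fun x => e x - s * d x))
      as [c [Hc Heq]].
    - intros x Hx. rewrite Rmin_left, Rmax_right in Hx by lra.
      apply (is_derive_minus psi (fun x => s * phi x)); [apply Hpsi; lra|].
      apply is_derive_scal, Hphi; lra.
    - intros x Hx. rewrite Rmin_left, Rmax_right in Hx by lra.
      apply continuity_pt_filterlim.
      apply (continuous_minus psi (fun x => s * phi x)).
      + apply ex_derive_continuous. eexists; apply Hpsi; lra.
      + apply (continuous_scal_r s phi).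
        apply (ex_derive_continuous phi). eexists; apply Hphi; lra.
    - rewrite Rmin_left, Rmax_right in Hc by lra.
      assert (H := Hde c Hc). apply Rabs_le_between in H.
      assert (0 <= (e c - s * d c) * (b - a)).
      { apply Rmult_le_pos; [|lra]. destruct Hs; subst s; lra. }
      lra. }
  apply Rabs_le. split.
  - specialize (Hs (-1)). lra.
  - specialize (Hs 1). lra.
Qed.

Lemma continuous_ex_RInt (f : R -> R) (a b : R) :
  (forall x, continuous f x) -> ex_RInt f a b.
Proof. intros Hf. apply (ex_RInt_continuous f). intros; apply Hf. Qed.

Lemma is_derive_primitive (f : R -> R) (a x : R) :
  (forall y, continuous f y) -> is_derive (fun T => RInt f a T) x (f x).
Proof.
  intros Hf. apply (is_derive_RInt f (fun T => RInt f a T) a x); [|apply Hf].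
  apply filter_forall. intros y. apply (RInt_correct f), continuous_ex_RInt, Hf.
Qed.

Lemma dominated_increment (f : R -> R) (B S T : R) :
  (forall x, continuous f x) ->
  (forall r, 0 <= r -> Rabs (f r) <= B * exp (- r)) ->
  0 <= S <= T ->
  Rabs (RInt f 0 T - RInt f 0 S) <= B * exp (- S) - B * exp (- T).
Proof.
  intros Hf Hb HST.
  replace (B * exp (- S) - B * exp (- T)) with (- B * exp (- T) - - B * exp (- S)) by ring.
  apply (increment_le (fun T => RInt f 0 T) (fun T => - B * exp (- T)) f
           (fun T => B * exp (- T))).
  - lra.
  - intros x _. apply is_derive_primitive, Hf.
  - intros x _. auto_derive; [easy|ring].
  - intros x Hx. apply Hb. lra.
Qed.

Lemma dominated_ex_lim (f : R -> R) (B : R) :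
  (forall x, continuous f x) ->
  (forall r, 0 <= r -> Rabs (f r) <= B * exp (- r)) ->
  exists l : R, is_lim (fun T => RInt f 0 T) p_infty l /\ Rabs l <= B.
Proof.
  intros Hf Hb.
  assert (HB : 0 <= B).
  { specialize (Hb 0 (Rle_refl 0)). rewrite Ropp_0, exp_0 in Hb.
    generalize (Rabs_pos (f 0)). lra. }
  assert (Hex : exists l : R,
    filterlim (fun T => RInt f 0 T) (Rbar_locally' p_infty) (locally l)).
  { apply (proj1 (filterlim_locally_cauchy (U := R_CompleteSpace)
                    (F := Rbar_locally' p_infty) (fun T => RInt f 0 T))).
    (* This threshold suffices because [u * exp (- u) < 1]: the tail [B * exp (- u)] is below [eps]
       once [B <= eps * u]. *)
    intros [eps Heps]. set (M := Rmax 0 (2 * B / eps)).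
    exists (fun T => M < T). split; [exists M; auto|].
    assert (Hw : forall u v, M < u -> u <= v -> Rabs (RInt f 0 v - RInt f 0 u) < eps).
    { intros u v Hu Huv.
      assert (Hu0 : 0 < u) by (unfold M in Hu; generalize (Rmax_l 0 (2 * B / eps)); lra).
      assert (Hu1 : 2 * B / eps < u)
        by (unfold M in Hu; generalize (Rmax_r 0 (2 * B / eps)); lra).
      eapply Rle_lt_trans; [apply (dominated_increment f B); auto; lra|].
      assert (He := exp_pos (- v)).
      assert (Hi : 1 + u < exp u) by (apply exp_ineq1; lra).
      assert (Heu : exp (- u) * exp u = 1) by (rewrite <- exp_plus, Rplus_opp_l; apply exp_0).
      assert (Hp := exp_pos (- u)).
      assert (B <= eps * u).
      { apply (Rmult_lt_compat_r eps) in Hu1; [|lra].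
        unfold Rdiv in Hu1. rewrite Rmult_assoc, Rinv_l in Hu1 by lra. nra. }
      assert (B * exp (- u) < eps).
      { apply Rle_lt_trans with (eps * u * exp (- u)); [nra|].
        assert (u * exp (-u) < 1) by nra. nra. }
      nra. }
    intros u v Hu Hv. destruct (Rle_lt_dec u v) as [Huv|Huv].
    - apply Hw; auto.
    - apply ball_sym, Hw; auto; lra. }
  destruct Hex as [l Hl]. exists l. split; [exact Hl|].
  assert (Hlim : is_lim (fun T => Rabs (RInt f 0 T)) p_infty (Rabs l))
    by exact (filterlim_comp _ _ _ _ Rabs _ _ _ Hl (continuous_Rabs l)).
  apply (is_lim_le_loc (fun T => Rabs (RInt f 0 T)) (fun _ => B) p_infty (Rabs l) B);
    [|exact Hlim|apply is_lim_const].
  exists 0. intros T HT.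
  assert (H := dominated_increment f B 0 T Hf Hb).
  rewrite RInt_point, Ropp_0, exp_0 in H. unfold zero in H; simpl in H.
  rewrite Rminus_0_r in H. assert (He := exp_pos (- T)).
  apply Rle_trans with (B * 1 - B * exp (- T)); [apply H; lra|nra].
Qed.

(** The shape of the integrals in [Ai] and [Bi]. Since [Lim] and [real] are total, the value means
    something only once convergence is known, hence the domination hypotheses that accompany it. *)
Definition improper (f : R -> R) : R := real (Lim (fun T => RInt f 0 T) p_infty).

Lemma improper_correct (f : R -> R) (B : R) :
  (forall x, continuous f x) ->
  (forall r, 0 <= r -> Rabs (f r) <= B * exp (- r)) ->
  is_lim (fun T => RInt f 0 T) p_infty (improper f) /\ Rabs (improper f) <= B.
Proof.
  intros Hf Hb. destruct (dominated_ex_lim f B Hf Hb) as [l [Hl HB]].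
  unfold improper. rewrite (is_lim_unique _ _ _ Hl). auto.
Qed.

Lemma improper_unique (f : R -> R) (l : R) :
  is_lim (fun T => RInt f 0 T) p_infty l -> improper f = l.
Proof. intros H. unfold improper. now rewrite (is_lim_unique _ _ _ H). Qed.

(** Takes the place of dominated convergence when differentiating under an improper integral: a
    second-order Taylor bound on the integrand, once integrated, is a bound of this form. *)
Lemma is_derive_quadratic (f : R -> R) (x d B : R) :
  (forall y, Rabs (f y - f x - d * (y - x)) <= B * (y - x) ^ 2) -> is_derive f x d.
Proof.
  intros H. apply is_derive_Reals. intros eps Heps.
  assert (HB : 0 <= Rabs B) by apply Rabs_pos.
  assert (Hd : 0 < eps / (Rabs B + 1)) by (apply Rdiv_lt_0_compat; lra).
  exists (mkposreal _ Hd). simpl. intros h Hh Hhd.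
  specialize (H (x + h)). replace (x + h - x) with h in H by ring.
  replace ((f (x + h) - f x) / h - d) with ((f (x + h) - f x - d * h) / h) by (field; lra).
  unfold Rdiv. rewrite Rabs_mult, Rabs_inv.
  assert (Hp : 0 < Rabs h) by (apply Rabs_pos_lt; lra).
  apply Rmult_lt_reg_r with (Rabs h); [lra|].
  rewrite Rmult_assoc, Rinv_l, Rmult_1_r by lra.
  eapply Rle_lt_trans; [exact H|].
  rewrite <- (pow2_abs h).
  assert (Rabs h * (Rabs B + 1) < eps).
  { apply (Rmult_lt_compat_r (Rabs B + 1)) in Hhd; [|lra].
    unfold Rdiv in Hhd. rewrite Rmult_assoc, Rinv_l in Hhd by lra. lra. }
  assert (B <= Rabs B) by apply Rle_abs. nra.
Qed.

Lemma is_lim_RInt_comb (f g : R -> R) (a b lf lg : R) :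
  (forall x, continuous f x) -> (forall x, continuous g x) ->
  is_lim (fun T => RInt f 0 T) p_infty lf -> is_lim (fun T => RInt g 0 T) p_infty lg ->
  is_lim (fun T => RInt (fun r => a * f r + b * g r) 0 T) p_infty (a * lf + b * lg).
Proof.
  intros Hf Hg Lf Lg.
  apply (is_lim_ext (fun T => a * RInt f 0 T + b * RInt g 0 T)).
  - intros T. symmetry. apply is_RInt_unique.
    apply (is_RInt_plus (fun r => scal a (f r)) (fun r => scal b (g r))).
    + apply (is_RInt_scal f), (RInt_correct f), continuous_ex_RInt, Hf.
    + apply (is_RInt_scal g), (RInt_correct g), continuous_ex_RInt, Hg.
  - apply is_lim_plus'.
    + apply (is_lim_scal_l (fun T => RInt f 0 T) a p_infty lf), Lf.
    + apply (is_lim_scal_l (fun T => RInt g 0 T) b p_infty lg), Lg.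
Qed.

Lemma continuous_comb (f g : R -> R) (a b x : R) :
  continuous f x -> continuous g x -> continuous (fun r => a * f r + b * g r) x.
Proof.
  intros Hf Hg. apply (continuous_plus (fun r => scal a (f r)) (fun r => scal b (g r)));
    [apply (continuous_scal_r a f)|apply (continuous_scal_r b g)]; assumption.
Qed.

Lemma improper_lin3 (f1 f2 f3 : R -> R) (B c : R) :
  (forall x, continuous f1 x) -> (forall x, continuous f2 x) -> (forall x, continuous f3 x) ->
  (forall r, 0 <= r -> Rabs (f1 r) <= B * exp (- r)) ->
  (forall r, 0 <= r -> Rabs (f2 r) <= B * exp (- r)) ->
  (forall r, 0 <= r -> Rabs (f3 r) <= B * exp (- r)) ->
  improper (fun r => f1 r - f2 r - f3 r * c)
    = improper f1 - improper f2 - improper f3 * c.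
Proof.
  intros H1 H2 H3 B1 B2 B3.
  destruct (improper_correct f1 B H1 B1) as [L1 _].
  destruct (improper_correct f2 B H2 B2) as [L2 _].
  destruct (improper_correct f3 B H3 B3) as [L3 _].
  apply improper_unique.
  assert (L := is_lim_RInt_comb _ _ 1 (- c) _ _
    (fun x => continuous_comb f1 f2 1 (-1) x (H1 x) (H2 x)) H3
    (is_lim_RInt_comb f1 f2 1 (-1) _ _ H1 H2 L1 L2) L3).
  replace (improper f1 - improper f2 - improper f3 * c)
    with (1 * (1 * improper f1 + -1 * improper f2) + - c * improper f3) by ring.
  eapply is_lim_ext; [|exact L].
  intros T. apply RInt_ext. intros x _. simpl. ring.
Qed.

(** * Oscillatory integrals as functions of their frequency *)

Lemma cos_taylor (x h : R) : Rabs (cos (x + h) - cos x + h * sin x) <= h ^ 2.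
Proof.
  assert (W : forall h, 0 <= h -> forall x, Rabs (cos (x + h) - cos x + h * sin x) <= h ^ 2).
  { clear. intros h Hh x.
    assert (Hs : forall t, 0 <= t -> Rabs (sin x - sin (x + t)) <= t).
    { intros t Ht.
      assert (H := increment_le (fun t => sin (x + t)) (fun t => t)
        (fun t => cos (x + t)) (fun _ => 1) 0 t Ht).
      cbv beta in H. rewrite Rplus_0_r, Rminus_0_r in H. rewrite Rabs_minus_sym. apply H.
      - intros; auto_derive; [easy|ring].
      - intros; auto_derive; [easy|ring].
      - intros; apply Rabs_le. assert (B := COS_bound (x + x0)). lra. }
    assert (H := increment_le (fun t => cos (x + t) + t * sin x) (fun t => t ^ 2)
        (fun t => sin x - sin (x + t)) (fun t => 2 * t) 0 h Hh).
    cbv beta in H. rewrite Rplus_0_r in H.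
    replace (cos (x + h) - cos x + h * sin x)
      with (cos (x + h) + h * sin x - (cos x + 0 * sin x)) by ring.
    replace (h ^ 2) with (h ^ 2 - 0 ^ 2) by ring. apply H.
    - intros; auto_derive; [easy|ring].
    - intros; auto_derive; [easy|ring].
    - intros t Ht. specialize (Hs t). lra. }
  destruct (Rle_lt_dec 0 h) as [H|H]; [now apply W|].
  specialize (W (- h) (ltac:(lra)) (- x)).
  rewrite <- Ropp_plus_distr, !cos_neg, sin_neg in W.
  replace (h * sin x) with (- h * - sin x) by ring.
  replace (h ^ 2) with ((- h) ^ 2) by ring. exact W.
Qed.

(* [t = 0] and [t = - PI / 2] are the cosine and sine transforms of [m]; a derivative in [e]
   shifts [t] by [PI / 2]. *)
Definition osc (m p : R -> R) (t e : R) : R := improper (fun r => m r * cos (t + e * p r)).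

Lemma continuous_osc_integrand (m p : R -> R) (t e x : R) :
  (forall r, continuous m r) -> (forall r, continuous p r) ->
  continuous (fun r => m r * cos (t + e * p r)) x.
Proof.
  intros Hm Hp. apply (continuous_mult m (fun r => cos (t + e * p r))); [apply Hm|].
  apply (continuous_comp (fun r => t + e * p r) cos).
  - apply (continuous_plus (fun _ => t) (fun r => e * p r)); [apply continuous_const|].
    apply (continuous_scal_r e p). apply Hp.
  - apply continuous_cos.
Qed.

Lemma osc_integrand_bound (m p : R -> R) (t e B r : R) :
  Rabs (m r) <= B -> Rabs (m r * cos (t + e * p r)) <= B.
Proof.
  intros H. rewrite Rabs_mult.
  assert (Rabs (cos (t + e * p r)) <= 1)
    by (apply Rabs_le; generalize (COS_bound (t + e * p r)); lra).
  assert (0 <= Rabs (m r)) by apply Rabs_pos. nra.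
Qed.

Lemma osc_bound (m p : R -> R) (t e B : R) :
  (forall r, continuous m r) -> (forall r, continuous p r) ->
  (forall r, 0 <= r -> Rabs (m r) <= B * exp (- r)) ->
  Rabs (osc m p t e) <= B.
Proof.
  intros Hm Hp Hb. apply improper_correct.
  - intros; now apply continuous_osc_integrand.
  - intros; apply osc_integrand_bound; auto.
Qed.

(** The Taylor remainder of the cosine is quadratic in [(y - e) * p r], so a majorant of [m * p^2]
    bounds the error of the difference quotient. The majorants of [m] and [m * p] make the two
    integrals themselves converge. *)
Lemma is_derive_osc (m p : R -> R) (t e B : R) :
  (forall r, continuous m r) -> (forall r, continuous p r) ->
  (forall r, 0 <= r -> Rabs (m r) <= B * exp (- r)) ->
  (forall r, 0 <= r -> Rabs (m r * p r) <= B * exp (- r)) ->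
  (forall r, 0 <= r -> Rabs (m r * p r * p r) <= B * exp (- r)) ->
  is_derive (osc m p t) e (osc (fun r => m r * p r) p (t + PI / 2) e).
Proof.
  intros Hm Hp B0 B1 B2.
  assert (Hmp : forall r, continuous (fun r => m r * p r) r)
    by (intros r; apply (continuous_mult m p); auto).
  apply is_derive_quadratic with B. intros y.
  unfold osc. rewrite <- (improper_lin3 _ _ _ B).
  2-4: intros; now apply continuous_osc_integrand.
  2-3: intros; apply osc_integrand_bound; auto.
  2: intros; apply (osc_integrand_bound (fun r => m r * p r)); auto.
  apply improper_correct.
  - intros x.
    apply (continuous_minus (fun r => m r * cos (t + y * p r) - m r * cos (t + e * p r))
             (fun r => m r * p r * cos (t + PI / 2 + e * p r) * (y - e))).
    + apply (continuous_minus (fun r => m r * cos (t + y * p r)));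
        now apply continuous_osc_integrand.
    + apply (continuous_mult (fun r => m r * p r * cos (t + PI / 2 + e * p r)) (fun _ => y - e)).
      * now apply (continuous_osc_integrand (fun r => m r * p r)).
      * apply continuous_const.
  - intros r Hr. specialize (B2 r Hr).
    assert (T := cos_taylor (t + e * p r) ((y - e) * p r)).
    replace (t + PI / 2 + e * p r) with (PI / 2 + (t + e * p r)) by ring.
    replace (t + y * p r) with (t + e * p r + (y - e) * p r) by ring.
    assert (Hc : cos (PI / 2 + (t + e * p r)) = - sin (t + e * p r)).
    { rewrite sin_cos. ring. }
    rewrite Hc.
    match goal with |- Rabs ?u <= _ =>
      replace u with (m r * (cos (t + e * p r + (y - e) * p r) - cos (t + e * p r)
        + (y - e) * p r * sin (t + e * p r))) by ring end.
    rewrite Rabs_mult.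
    apply Rle_trans with (Rabs (m r) * ((y - e) * p r) ^ 2).
    { apply Rmult_le_compat_l; [apply Rabs_pos|exact T]. }
    rewrite !Rabs_mult in B2.
    rewrite <- (pow2_abs ((y - e) * p r)), Rabs_mult, <- (pow2_abs (y - e)).
    assert (0 <= Rabs (y - e) ^ 2) by apply pow2_ge_0. nra.
Qed.

(** * The integral through the saddle point *)

Definition hsqrt3 : R := sqrt 3 / 2.

Lemma hsqrt3_sqr : hsqrt3 * hsqrt3 = 3 / 4.
Proof. unfold hsqrt3. assert (H := sqrt_sqrt 3 ltac:(lra)). nra. Qed.

Lemma hsqrt3_pos : 0 < hsqrt3.
Proof. unfold hsqrt3. assert (H := sqrt_lt_R0 3 ltac:(lra)). lra. Qed.

(** With [N = n + 1], raise [r / N <= exp (r / N)] to the power [n]; the exponent [n * r / N] stays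
    below [r]. The shift by one keeps the division legitimate for [n = 0]. *)
Lemma pow_le_exp (n : nat) (r : R) : 0 <= r -> r ^ n <= (INR n + 1) ^ n * exp r.
Proof.
  intros Hr. set (N := INR n + 1).
  assert (HN : 0 < N) by (unfold N; generalize (pos_INR n); lra).
  assert (H1 : r / N <= exp (r / N)) by (generalize (exp_ineq1_le (r / N)); lra).
  assert (H0 : 0 <= r / N) by (apply Rdiv_le_0_compat; lra).
  assert (H2 : (r / N) ^ n <= exp (r / N) ^ n) by (apply pow_incr; lra).
  replace r with (N * (r / N)) at 1 by (field; lra).
  rewrite Rpow_mult_distr. apply Rmult_le_compat_l; [apply pow_le; lra|].
  eapply Rle_trans; [exact H2|].
  rewrite <- Rpower_pow by apply exp_pos. unfold Rpower. rewrite ln_exp.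
  destruct (Rle_lt_or_eq_dec 0 r Hr) as [Hlt|Heq].
  - left. apply exp_increasing. apply Rmult_lt_reg_r with N; [lra|].
    replace (INR n * (r / N) * N) with (INR n * r) by (field; lra). unfold N. nra.
  - subst r. unfold Rdiv. rewrite Rmult_0_l, Rmult_0_r. lra.
Qed.

(** Completing the square gives [- hsqrt3 * r^2 <= / hsqrt3 - 2 * r]. One factor [exp (- r)] pays
    for the power [r^n], the other remains as decay. *)
Lemma gauss_dominated (n : nat) :
  exists B, 0 < B /\ forall r, 0 <= r -> exp (- hsqrt3 * r ^ 2) * r ^ n <= B * exp (- r).
Proof.
  exists ((INR n + 1) ^ n * exp (/ hsqrt3)). split.
  - apply Rmult_lt_0_compat; [|apply exp_pos]. apply pow_lt. generalize (pos_INR n). lra.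
  - intros r Hr. assert (Hp := hsqrt3_pos).
    assert (H := pow_le_exp n r Hr).
    apply Rle_trans with (exp (- hsqrt3 * r ^ 2) * ((INR n + 1) ^ n * exp r)).
    + apply Rmult_le_compat_l; [left; apply exp_pos|exact H].
    + replace (exp (- hsqrt3 * r ^ 2) * ((INR n + 1) ^ n * exp r))
        with ((INR n + 1) ^ n * (exp (- hsqrt3 * r ^ 2) * exp r)) by ring.
      rewrite Rmult_assoc. apply Rmult_le_compat_l.
      { apply pow_le. generalize (pos_INR n). lra. }
      rewrite <- !exp_plus.
      assert (He : - hsqrt3 * r ^ 2 + r <= / hsqrt3 + - r).
      { assert (0 <= hsqrt3 * (r - / hsqrt3) ^ 2)
          by (apply Rmult_le_pos; [lra|apply pow2_ge_0]).
        replace (hsqrt3 * (r - / hsqrt3) ^ 2) with (hsqrt3 * r ^ 2 - 2 * r + / hsqrt3) in H0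
          by (field; lra). lra. }
      destruct He as [He|He]; [left; now apply exp_increasing|rewrite He; lra].
Qed.

Definition cubic (r : R) : R := r ^ 3 / 3.

Lemma continuous_cubic r : continuous cubic r.
Proof. apply (ex_derive_continuous cubic). unfold cubic. auto_derive. easy. Qed.

(* The shifted Airy integral on the line through the saddle point, as a function of
   [e = z^(-3/4)]: its real part for [t r = cos (r^2/2)], imaginary for [sin (r^2/2)]. *)
Definition saddle (t : R -> R) (e : R) : R :=
  osc (fun r => exp (- hsqrt3 * r ^ 2) * t r) cubic 0 e.

Lemma continuous_gauss_weight (t : R -> R) r :
  (forall r, continuous t r) -> continuous (fun r => exp (- hsqrt3 * r ^ 2) * t r) r.
Proof.
  intros Ht. apply (continuous_mult (fun r => exp (- hsqrt3 * r ^ 2)) t); [|apply Ht].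
  apply (ex_derive_continuous (fun r => exp (- hsqrt3 * r ^ 2))). auto_derive. easy.
Qed.

(** Each derivative in [e] brings down a factor [cubic r], and [is_derive_osc] looks two factors
    ahead. Two derivatives therefore need the moments of degree 0, 3, 6 and 9. [B] is chosen before
    [t], so that it serves both the cosine and the sine part of [K]. *)
Lemma saddle_smooth :
  exists B, 0 < B /\ forall t : R -> R,
    (forall r, continuous t r) -> (forall r, Rabs (t r) <= 1) ->
    (forall r, 0 <= r -> Rabs (exp (- hsqrt3 * r ^ 2) * t r) <= B * exp (- r)) /\
    exists K1 K2 : R -> R, forall e,
      is_derive (saddle t) e (K1 e) /\ is_derive K1 e (K2 e) /\
      Rabs (saddle t e) <= B /\ Rabs (K1 e) <= B /\ Rabs (K2 e) <= B.
Proof.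
  destruct (gauss_dominated 0) as [b0 [P0 B0]].
  destruct (gauss_dominated 3) as [b1 [P1 B1]].
  destruct (gauss_dominated 6) as [b2 [P2 B2]].
  destruct (gauss_dominated 9) as [b3 [P3 B3]].
  exists (b0 + b1 + b2 + b3). split; [lra|]. intros t Ht Ht1.
  set (m := fun r => exp (- hsqrt3 * r ^ 2) * t r).
  assert (Hm : forall r, continuous m r) by (intros; now apply continuous_gauss_weight).
  assert (Hmp : forall r, continuous (fun r => m r * cubic r) r)
    by (intros; apply (continuous_mult m cubic); [apply Hm|apply continuous_cubic]).
  assert (Hmpp : forall r, continuous (fun r => m r * cubic r * cubic r) r)
    by (intros; apply (continuous_mult (fun r => m r * cubic r) cubic);
        [apply Hmp|apply continuous_cubic]).
  assert (Hpow : forall r, 0 <= r -> Rabs (cubic r) <= r ^ 3).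
  { intros r Hr. assert (0 <= r ^ 3) by now apply pow_le.
    unfold cubic. rewrite Rabs_pos_eq; lra. }
  assert (Hg : forall r, 0 < exp (- hsqrt3 * r ^ 2)) by (intros; apply exp_pos).
  assert (Hma : forall r, Rabs (m r) <= exp (- hsqrt3 * r ^ 2)).
  { intros r. unfold m. rewrite Rabs_mult, (Rabs_pos_eq (exp _)) by (left; apply Hg).
    specialize (Hg r). specialize (Ht1 r). nra. }
  set (b := b0 + b1 + b2 + b3).
  assert (W : forall y c r, y <= c * exp (- r) -> c <= b -> y <= b * exp (- r)).
  { intros y c r Hy Hc. eapply Rle_trans; [exact Hy|].
    apply Rmult_le_compat_r; [left; apply exp_pos|exact Hc]. }
  assert (D0 : forall r, 0 <= r -> Rabs (m r) <= b * exp (- r)).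
  { intros r Hr. apply W with b0; [|unfold b; lra].
    specialize (B0 r Hr). rewrite pow_O, Rmult_1_r in B0.
    eapply Rle_trans; [apply Hma|exact B0]. }
  assert (D1 : forall r, 0 <= r -> Rabs (m r * cubic r) <= b * exp (- r)).
  { intros r Hr. apply W with b1; [|unfold b; lra].
    eapply Rle_trans; [|exact (B1 r Hr)]. rewrite Rabs_mult.
    apply Rmult_le_compat; auto using Rabs_pos. }
  assert (D2 : forall r, 0 <= r -> Rabs (m r * cubic r * cubic r) <= b * exp (- r)).
  { intros r Hr. apply W with b2; [|unfold b; lra].
    eapply Rle_trans; [|exact (B2 r Hr)]. rewrite !Rabs_mult.
    replace (exp (- hsqrt3 * r ^ 2) * r ^ 6)
      with (exp (- hsqrt3 * r ^ 2) * r ^ 3 * r ^ 3) by ring.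
    repeat apply Rmult_le_compat; auto using Rabs_pos, Rmult_le_pos. }
  assert (D3 : forall r, 0 <= r ->
    Rabs (m r * cubic r * cubic r * cubic r) <= b * exp (- r)).
  { intros r Hr. apply W with b3; [|unfold b; lra].
    eapply Rle_trans; [|exact (B3 r Hr)]. rewrite !Rabs_mult.
    replace (exp (- hsqrt3 * r ^ 2) * r ^ 9)
      with (exp (- hsqrt3 * r ^ 2) * r ^ 3 * r ^ 3 * r ^ 3) by ring.
    repeat apply Rmult_le_compat; auto using Rabs_pos, Rmult_le_pos. }
  split; [exact D0|].
  exists (osc (fun r => m r * cubic r) cubic (0 + PI / 2)),
         (osc (fun r => m r * cubic r * cubic r) cubic (0 + PI / 2 + PI / 2)).
  intros e. assert (Hc := continuous_cubic).
  refine (conj _ (conj _ (conj _ (conj _ _)))).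
  - exact (is_derive_osc m _ _ _ _ Hm Hc D0 D1 D2).
  - exact (is_derive_osc (fun r => m r * cubic r) _ _ _ _ Hmp Hc D1 D2 D3).
  - exact (osc_bound m _ _ _ _ Hm Hc D0).
  - exact (osc_bound (fun r => m r * cubic r) _ _ _ _ Hmp Hc D1).
  - exact (osc_bound (fun r => m r * cubic r * cubic r) _ _ _ _ Hmpp Hc D2).
Qed.

Lemma half_sqr_trig_continuous :
  (forall r, continuous (fun r => cos (r ^ 2 / 2)) r) /\
  (forall r, continuous (fun r => sin (r ^ 2 / 2)) r).
Proof.
  split; intros r; [apply (ex_derive_continuous (fun r => cos (r ^ 2 / 2)))
    |apply (ex_derive_continuous (fun r => sin (r ^ 2 / 2)))]; auto_derive; easy.
Qed.

(** Keeps [K] away from zero near [e = 0], so that its argument is an arctangent. Write the minorant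
    [1 - r^4/4] of the cosine as [3/4 + (1 - r^4)/4]: the second part integrates to a nonnegative
    boundary term, and the first contributes at least [3/4] times the integral of the Gaussian over
    [[0,1]], where it is at least [exp (- hsqrt3)]. *)
Lemma saddle_re_pos : exists c, 0 < c /\ c <= saddle (fun r => cos (r ^ 2 / 2)) 0.
Proof.
  assert (Hp := hsqrt3_pos). assert (Hs := hsqrt3_sqr).
  destruct saddle_smooth as [B [HB Hsm]].
  destruct half_sqr_trig_continuous as [Cc _].
  destruct (Hsm (fun r => cos (r ^ 2 / 2)) Cc) as [Hdom _].
  { intros; apply Rabs_le; generalize (COS_bound (r ^ 2 / 2)); lra. }
  set (f := fun r => exp (- hsqrt3 * r ^ 2) * cos (r ^ 2 / 2)) in *.
  assert (Hf : forall r, continuous f r)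
    by (intros; now apply (continuous_gauss_weight (fun r => cos (r ^ 2 / 2)))).
  set (gs := fun r => exp (- hsqrt3 * r ^ 2)).
  assert (Hgs : forall r, continuous gs r)
    by (intros; apply (ex_derive_continuous gs); unfold gs; auto_derive; easy).
  exists (3 / 4 * exp (- hsqrt3)). split.
  { apply Rmult_lt_0_compat; [lra|apply exp_pos]. }
  assert (Heq : saddle (fun r => cos (r ^ 2 / 2)) 0 = improper f).
  { unfold saddle, osc, improper. f_equal. apply Lim_ext. intros T. apply RInt_ext.
    intros x _. rewrite Rmult_0_l, Rplus_0_r, cos_0. symmetry. apply Rmult_1_r. }
  rewrite Heq. destruct (improper_correct f B Hf Hdom) as [Hlim _].
  apply (is_lim_le_loc (fun _ => 3 / 4 * exp (- hsqrt3)) (fun T => RInt f 0 T) p_infty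
           (3 / 4 * exp (- hsqrt3)) (improper f)); [|apply is_lim_const|exact Hlim].
  exists 1. intros T HT.
  assert (G1 := increment_le (fun r => r * exp (- hsqrt3)) (fun T => RInt gs 0 T)
    (fun _ => exp (- hsqrt3)) gs 0 1 Rle_0_1).
  assert (G2 := increment_le (fun r => 0) (fun T => RInt gs 0 T)
    (fun _ => 0) gs 1 T (ltac:(lra))).
  (* [cos (r^2/2) >= 1 - r^4/4], and [(1 - r^4) exp (- a r^2)] has the explicit
     primitive [(r^3/(2a) + r) exp (- a r^2)] because [4 a^2 = 3]. *)
  assert (G3 := increment_le (fun r => 0)
    (fun T => RInt f 0 T - (3 / 4 * RInt gs 0 T
       + / 4 * ((T ^ 3 / (2 * hsqrt3) + T) * exp (- hsqrt3 * T ^ 2))))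
    (fun _ => 0)
    (fun r => f r - (3 / 4 * gs r + / 4 * ((1 - r ^ 4) * gs r))) 0 T (ltac:(lra))).
  cbv beta in G1, G2, G3. rewrite !RInt_point in G1, G3. change zero with 0 in G1, G3.
  assert (L1 : exp (- hsqrt3) <= RInt gs 0 1).
  { assert (H : Rabs (1 * exp (- hsqrt3) - 0 * exp (- hsqrt3)) <= RInt gs 0 1 - 0).
    { apply G1.
      - intros; auto_derive; [easy|ring].
      - intros; now apply is_derive_primitive.
      - intros x Hx. rewrite Rabs_pos_eq by (left; apply exp_pos). unfold gs.
        assert (- hsqrt3 <= - hsqrt3 * x ^ 2) by nra.
        destruct H as [H|H]; [left; now apply exp_increasing|rewrite <- H; lra]. }
    generalize (Rle_abs (1 * exp (- hsqrt3) - 0 * exp (- hsqrt3))). lra. }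
  assert (L2 : 0 <= RInt gs 0 T - RInt gs 0 1).
  { rewrite Rminus_0_r, Rabs_R0 in G2. apply G2.
    - intros; apply is_derive_Reals, derivable_pt_lim_const.
    - intros; now apply is_derive_primitive.
    - intros. left; apply exp_pos. }
  rewrite Rminus_0_r, Rabs_R0 in G3.
  assert (L3 : 0 <= (T ^ 3 / (2 * hsqrt3) + T) * exp (- hsqrt3 * T ^ 2)).
  { apply Rmult_le_pos; [|left; apply exp_pos].
    assert (0 <= T ^ 3 / (2 * hsqrt3)) by (apply Rdiv_le_0_compat; [apply pow_le; lra|lra]).
    lra. }
  assert (L4 := G3 (fun _ _ => (proj2 (is_derive_Reals _ _ _)) (derivable_pt_lim_const 0 _))).
  apply Rle_trans with (3 / 4 * RInt gs 0 T
       + / 4 * ((T ^ 3 / (2 * hsqrt3) + T) * exp (- hsqrt3 * T ^ 2))); [lra|].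
  apply Rminus_le_0. eapply Rle_trans; [apply L4|].
  - intros x _.
    apply (is_derive_minus (fun T => RInt f 0 T)); [now apply is_derive_primitive|].
    apply (is_derive_plus (fun T => 3 / 4 * RInt gs 0 T)).
    + apply (is_derive_scal (fun T => RInt gs 0 T)). now apply is_derive_primitive.
    + unfold gs. auto_derive; [easy|].
      replace (x * (x * 1)) with (x ^ 2) by ring.
      assert (Hi : / (2 * hsqrt3) = 2 / 3 * hsqrt3).
      { apply Rmult_eq_reg_r with (2 * hsqrt3); [|lra].
        rewrite Rinv_l by lra. nra. }
      unfold Rdiv. rewrite ?Hi.
      match goal with |- ?l = ?r => change (@eq R l r) end. ring_simplify.
      replace (hsqrt3 ^ 2) with (3 / 4) by (rewrite <- Hs; ring). field.
  - intros x _.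
    assert (Ht := cos_taylor 0 (x ^ 2 / 2)).
    rewrite Rplus_0_l, cos_0, sin_0 in Ht. apply Rabs_le_between in Ht.
    unfold f, gs. assert (E := exp_pos (- hsqrt3 * x ^ 2)). 
    match goal with |- 0 <= ?u => replace u with
      (exp (- hsqrt3 * x ^ 2) * (cos (x ^ 2 / 2) - 1 + x ^ 4 / 4)) by field end.
    apply Rmult_le_pos; [lra|].
    replace (x ^ 4) with (4 * (x ^ 2 / 2) ^ 2) by field. lra.
  - replace ((0 ^ 3 / (2 * hsqrt3) + 0) * exp (- hsqrt3 * 0 ^ 2)) with 0
      by (unfold Rdiv; ring). rewrite (RInt_point 0 gs). change zero with 0. lra.
Qed.

Lemma Rabs_minus_le (x y : R) : Rabs (x - y) <= Rabs x + Rabs y.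
Proof. rewrite <- (Rabs_Ropp y). apply Rabs_triang. Qed.

(** With [K = u + i v], the function [q = atan (v / u)] is a smooth argument wherever [u > 0], and
    [q' = (v' u - v u') / (u^2 + v^2)]. Only derivatives of [q] are bounded, because only they enter
    [gamma'] and [gamma'']. *)
Lemma saddle_phase :
  exists (B e0 : R) (q q1 q2 : R -> R), 0 < B /\ 0 < e0 /\ forall e, Rabs e < e0 ->
    is_derive q e (q1 e) /\ is_derive q1 e (q2 e) /\ Rabs (q1 e) <= B /\ Rabs (q2 e) <= B /\
    exists rho, 0 < rho /\
      saddle (fun r => cos (r ^ 2 / 2)) e = rho * cos (q e) /\
      saddle (fun r => sin (r ^ 2 / 2)) e = rho * sin (q e).
Proof.
  destruct saddle_smooth as [B [HB Hsm]].
  destruct half_sqr_trig_continuous as [Cc Cs].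
  destruct saddle_re_pos as [c [Hc0 Hc]].
  destruct (Hsm (fun r : R => cos (r ^ 2 / 2)) Cc) as [_ [u1 [u2 Hu]]].
  { intros; apply Rabs_le; generalize (COS_bound (r ^ 2 / 2)); lra. }
  destruct (Hsm (fun r : R => sin (r ^ 2 / 2)) Cs) as [_ [v1 [v2 Hv]]].
  { intros; apply Rabs_le; generalize (SIN_bound (r ^ 2 / 2)); lra. }
  clear Hsm. set (u := saddle (fun r => cos (r ^ 2 / 2))) in *.
  set (v := saddle (fun r => sin (r ^ 2 / 2))) in *.
  set (D := fun e => u e ^ 2 + v e ^ 2).
  set (N := fun e => v1 e * u e - v e * u1 e).
  assert (Hpos : forall e, Rabs e < c / (2 * B) -> c / 2 <= u e).
  { intros e He.
    assert (Hw : Rabs (u e - u 0) <= B * Rabs e).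
    { destruct (Rle_lt_dec 0 e) as [H|H].
      - assert (I := increment_le u (fun t => B * t) u1 (fun _ => B) 0 e H).
        rewrite (Rabs_pos_eq e) by lra. replace (B * e) with (B * e - B * 0) by ring.
        apply I; intros; [apply Hu|auto_derive; [easy|ring]|apply Hu].
      - assert (I := increment_le u (fun t => B * t) u1 (fun _ => B) e 0 (ltac:(lra))).
        rewrite (Rabs_left e) by lra. rewrite Rabs_minus_sym.
        replace (B * - e) with (B * 0 - B * e) by ring.
        apply I; intros; [apply Hu|auto_derive; [easy|ring]|apply Hu]. }
    assert (B * Rabs e <= c / 2).
    { apply (Rmult_lt_compat_l B) in He; [|lra].
      replace (B * (c / (2 * B))) with (c / 2) in He by (field; lra). lra. }
    apply Rabs_le_between in Hw. lra. }
  set (k := c ^ 2 / 4).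
  assert (Hk : 0 < k) by (unfold k; nra).
  (* The first summand bounds [q1], the other two bound the two terms of [q2]. Within the radius
     [c / (2 * B)] the function [u] drops by at most [c / 2] from [u 0 >= c], so the denominator [D]
     is at least [k = c^2/4]. *)
  exists (2 * B ^ 2 / k + (2 * B ^ 2) / k + (2 * B ^ 2) * (4 * B ^ 2) / k ^ 2), (c / (2 * B)),
    (fun e => atan (v e / u e)), (fun e => N e / D e),
    (fun e => (v2 e * u e - v e * u2 e) / D e
              - N e * (2 * (u e * u1 e + v e * v1 e)) / D e ^ 2).
  assert (P1 : 0 < 2 * B ^ 2 / k) by (apply Rdiv_lt_0_compat; nra).
  assert (P2 : 0 < (2 * B ^ 2) * (4 * B ^ 2) / k ^ 2).
  { apply Rdiv_lt_0_compat; [apply Rmult_lt_0_compat; nra|nra]. }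
  split; [lra|]. split; [apply Rdiv_lt_0_compat; lra|].
  intros e He. specialize (Hpos e He).
  destruct (Hu e) as [Du [Du1 [Bu [Bu1 Bu2]]]].
  destruct (Hv e) as [Dv [Dv1 [Bv [Bv1 Bv2]]]].
  assert (HD : k <= D e) by (unfold k, D; nra).
  assert (Hprod : forall x y, Rabs x <= B -> Rabs y <= B -> Rabs (x * y) <= B ^ 2).
  { intros x y Hx Hy. rewrite Rabs_mult. replace (B ^ 2) with (B * B) by ring.
    apply Rmult_le_compat; auto using Rabs_pos. }
  assert (Hdet : forall x y z w, Rabs x <= B -> Rabs y <= B -> Rabs z <= B -> Rabs w <= B ->
    Rabs (x * y - z * w) <= 2 * B ^ 2).
  { intros x y z w Hx Hy Hz Hw.
    generalize (Rabs_minus_le (x * y) (z * w)) (Hprod x y Hx Hy) (Hprod z w Hz Hw). lra. }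
  assert (HN : Rabs (N e) <= 2 * B ^ 2) by (apply Hdet; auto).
  assert (Hquot : forall x y m n, 0 < n -> n <= y -> Rabs x <= m -> Rabs (x / y) <= m / n).
  { intros x y m n Hn Hy Hx. unfold Rdiv. rewrite Rabs_mult, Rabs_inv, (Rabs_pos_eq y) by lra.
    apply Rmult_le_compat; [apply Rabs_pos|left; apply Rinv_0_lt_compat; lra|exact Hx|].
    apply Rinv_le_contravar; lra. }
  refine (conj _ (conj _ (conj _ (conj _ _)))).
  - assert (H : is_derive (fun e => v e / u e) e ((v1 e * u e - v e * u1 e) / u e ^ 2)).
    { apply (is_derive_div v u); [exact Dv|exact Du|lra]. }
    assert (Ha : is_derive atan (v e / u e) (/ (1 + (v e / u e) ^ 2))).
    { apply is_derive_Reals. apply derivable_pt_lim_atan. }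
    assert (Hcmp := is_derive_comp atan (fun e => v e / u e) e _ _ Ha H).
    replace (N e / D e) with (scal ((v1 e * u e - v e * u1 e) / u e ^ 2) (/ (1 + (v e / u e) ^ 2))).
    { exact Hcmp. }
    unfold scal; simpl; unfold mult; simpl. unfold N, D. field.
    repeat split; try lra. change (D e <> 0). lra.
  - unfold N, D. auto_derive.
    + assert (X1 : ex_derive u e) by (exists (u1 e); exact Du).
      assert (X2 : ex_derive v e) by (exists (v1 e); exact Dv).
      assert (X3 : ex_derive u1 e) by (exists (u2 e); exact Du1).
      assert (X4 : ex_derive v1 e) by (exists (v2 e); exact Dv1).
      assert (X5 : D e <> 0) by lra.
      repeat apply conj; try exact I; assumption.
    + replace (Derive (fun x => u x) e) with (u1 e) by (symmetry; now apply is_derive_unique).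
      replace (Derive (fun x => v x) e) with (v1 e) by (symmetry; now apply is_derive_unique).
      replace (Derive (fun x => u1 x) e) with (u2 e) by (symmetry; now apply is_derive_unique).
      replace (Derive (fun x => v1 x) e) with (v2 e) by (symmetry; now apply is_derive_unique).
      field. change (D e <> 0). lra.
  - generalize (Hquot (N e) (D e) (2 * B ^ 2) k Hk HD HN). lra.
  - assert (HD2 : k ^ 2 <= D e ^ 2) by (apply pow_incr; lra).
    assert (H1 := Hquot _ _ _ _ Hk HD (Hdet _ _ _ _ Bv2 Bu Bv Bu2)).
    assert (H2 : Rabs (N e * (2 * (u e * u1 e + v e * v1 e))) <= 2 * B ^ 2 * (4 * B ^ 2)).
    { rewrite Rabs_mult. apply Rmult_le_compat; auto using Rabs_pos.
      rewrite Rabs_mult, (Rabs_pos_eq 2) by lra.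
      generalize (Rabs_triang (u e * u1 e) (v e * v1 e)) (Hprod _ _ Bu Bu1) (Hprod _ _ Bv Bv1).
      lra. }
    assert (H3 := Hquot _ _ _ _ (pow_lt _ 2 Hk) HD2 H2).
    eapply Rle_trans; [apply Rabs_minus_le|]. lra.
  - assert (Hq : 0 < 1 + (v e / u e) ^ 2) by (generalize (pow2_ge_0 (v e / u e)); lra).
    exists (u e * sqrt (1 + (v e / u e) ^ 2)).
    assert (Hs := sqrt_lt_R0 _ Hq).
    split; [apply Rmult_lt_0_compat; lra|].
    rewrite cos_atan, sin_atan, Rsqr_pow2. split; field; try split; lra.
Qed.

(** * Contour shift for the Airy integrals *)

(** Cauchy's theorem in real form: [P dx + Q dy] is closed, with common cross derivative [D], hence
    exact on the plane. The conclusion is a chain rule along an arbitrary differentiable curve, so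
    that the axes, the slanted line and the connecting segments are all instances of it. *)
Lemma potential_exists (P Q D : R -> R -> R) :
  (forall x y, is_derive (P x) y (D x y)) ->
  (forall x y, is_derive (fun x => Q x y) x (D x y)) ->
  (forall x y, continuous (fun u : R * R => P (fst u) (snd u)) (x, y)) ->
  (forall x y, continuous (fun u : R * R => Q (fst u) (snd u)) (x, y)) ->
  (forall x y, continuous (fun u : R * R => D (fst u) (snd u)) (x, y)) ->
  exists Phi : R -> R -> R, forall (X Y : R -> R) (t dX dY : R),
    is_derive X t dX -> is_derive Y t dY ->
    is_derive (fun t => Phi (X t) (Y t)) t (P (X t) (Y t) * dX + Q (X t) (Y t) * dY).
Proof.
  intros HP HQ CP CQ CD.
  assert (CPx : forall y x, continuous (fun x => P x y) x).
  { intros y x. apply (continuous_comp_2 (fun x => x) (fun _ => y) P);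
      [apply continuous_id|apply continuous_const|apply CP]. }
  assert (CQy : forall x y, continuous (Q x) y).
  { intros x y. apply (continuous_comp_2 (fun _ => x) (fun y => y) Q);
      [apply continuous_const|apply continuous_id|apply CQ]. }
  assert (CDy : forall x y, continuous (D x) y).
  { intros x y. apply (continuous_comp_2 (fun _ => x) (fun y => y) D);
      [apply continuous_const|apply continuous_id|apply CD]. }
  assert (EP : forall x y, RInt (D x) 0 y = P x y - P x 0).
  { intros x y. apply is_RInt_unique. apply (is_RInt_derive (P x) (D x) 0 y).
    - intros; apply HP.
    - intros; apply CDy. }
  set (Phi := fun x y => RInt (fun t => P t 0) 0 x + RInt (Q x) 0 y).
  assert (Dx : forall x y, is_derive (fun x => Phi x y) x (P x y)).
  { intros x y. unfold Phi.
    replace (P x y) with (plus (P x 0) (RInt (D x) 0 y))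
      by (rewrite EP; unfold plus; simpl; ring).
    apply (is_derive_plus (fun x => RInt (fun t => P t 0) 0 x) (fun x => RInt (Q x) 0 y)).
    - apply (is_derive_primitive (fun t => P t 0)). apply CPx.
    (* Differentiation under the integral turns the vertical part of the path into the integral of
       [D], which is [P x y - P x 0]; the horizontal part supplies the missing [P x 0]. *)
    - replace (RInt (D x) 0 y) with (RInt (fun t => Derive (fun u => Q u t) x) 0 y).
      + apply (is_derive_RInt_param Q 0 y x).
        * apply filter_forall. intros x0 t _. exists (D x0 t). apply HQ.
        * intros t _. apply (continuity_2d_pt_ext D).
          { intros u v. symmetry. apply is_derive_unique, HQ. }
          apply continuity_2d_pt_filterlim. apply CD.
        * apply filter_forall. intros x0. apply continuous_ex_RInt. apply CQy.
      + apply RInt_ext. intros t _. apply is_derive_unique, HQ. }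
  assert (Dy : forall x y, is_derive (Phi x) y (Q x y)).
  { intros x y. unfold Phi.
    replace (Q x y) with (plus 0 (Q x y)) by (unfold plus; simpl; ring).
    apply (is_derive_plus (fun _ => RInt (fun t => P t 0) 0 x) (fun y => RInt (Q x) 0 y)).
    - apply (is_derive_const (V := R_NormedModule)).
    - apply is_derive_primitive. apply CQy. }
  exists Phi. intros X Y t dX dY HX HY.
  assert (HF := is_derive_filterdiff Phi (X t) (Y t) P (Q (X t) (Y t))
    (filter_forall _ (fun u => Dx (fst u) (snd u))) (Dy (X t) (Y t)) (CP (X t) (Y t))).
  unfold is_derive.
  assert (HC := filterdiff_comp'_2 X Y Phi t (fun y => scal y dX) (fun y => scal y dY)
    (fun a b => plus (scal a (P (X t) (Y t))) (scal b (Q (X t) (Y t)))) HX HY HF).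
  apply (filterdiff_ext_lin _ _ _ HC).
  intros y. unfold scal, plus; simpl; unfold mult; simpl. ring.
Qed.

Ltac continuity2 :=
  lazymatch goal with
  | |- continuous (fun u => @?f u + @?g u) _ => apply (continuous_plus f g); continuity2
  | |- continuous (fun u => @?f u - @?g u) _ => apply (continuous_minus f g); continuity2
  | |- continuous (fun u => @?f u * @?g u) _ => apply (continuous_mult f g); continuity2
  | |- continuous (fun u => - @?f u) _ => apply (continuous_opp f); continuity2
  | |- continuous (fun u => exp (@?f u)) _ =>
      apply (continuous_comp f exp); [continuity2|apply continuous_exp]
  | |- continuous (fun u => cos (@?f u)) _ =>
      apply (continuous_comp f cos); [continuity2|apply continuous_cos]
  | |- continuous (fun u => sin (@?f u)) _ =>
      apply (continuous_comp f sin); [continuity2|apply continuous_sin]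
  | |- continuous (fun u => fst u) _ => apply continuous_fst
  | |- continuous (fun u => snd u) _ => apply continuous_snd
  | |- _ => apply continuous_const
  end.

(* [airy_re + i airy_im] is the exponent [- v^3/3 - z v] at [v = x + i y]. *)
Definition airy_re (z x y : R) : R := - (x ^ 3 - 3 * x * y ^ 2) / 3 - z * x.
Definition airy_im (z x y : R) : R := - (3 * x ^ 2 * y - y ^ 3) / 3 - z * y.

(* [Phi] is the real part of a primitive of [exp (i tau - v^3/3 - z v)]; both parts of the
   Airy integral are covered by [tau = 0] and [tau = - PI / 2]. *)
Definition airy_potential (z tau : R) (Phi : R -> R -> R) : Prop :=
  forall (X Y : R -> R) (t dX dY : R),
    is_derive X t dX -> is_derive Y t dY ->
    is_derive (fun t => Phi (X t) (Y t)) t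
      (exp (airy_re z (X t) (Y t)) *
        (cos (airy_im z (X t) (Y t) + tau) * dX - sin (airy_im z (X t) (Y t) + tau) * dY)).

(** For the integrand [f] one has [Re (f dv) = Re f dx - Im f dy], which gives the two components;
    that their cross derivatives agree is a Cauchy-Riemann equation. *)
Lemma airy_potential_exists (z tau : R) : exists Phi, airy_potential z tau Phi.
Proof.
  destruct (potential_exists
    (fun x y => exp (airy_re z x y) * cos (airy_im z x y + tau))
    (fun x y => - (exp (airy_re z x y) * sin (airy_im z x y + tau)))
    (fun x y => exp (airy_re z x y) * (2 * x * y * cos (airy_im z x y + tau)
         - (- x ^ 2 + y ^ 2 - z) * sin (airy_im z x y + tau)))) as [Phi H].
  - intros x y. unfold airy_re, airy_im. auto_derive; [easy|]. simpl. unfold Rminus, Rdiv. field.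
  - intros x y. unfold airy_re, airy_im. auto_derive; [easy|]. simpl. unfold Rminus, Rdiv. field.
  - intros x y. unfold airy_re, airy_im, Rdiv. simpl. continuity2.
  - intros x y. unfold airy_re, airy_im, Rdiv. simpl. continuity2.
  - intros x y. unfold airy_re, airy_im, Rdiv. simpl. continuity2.
  - exists Phi. intros X Y t dX dY HX HY. assert (H1 := H X Y t dX dY HX HY).
    cbv beta in H1.
    match goal with |- is_derive _ _ ?u => match type of H1 with is_derive _ _ ?v =>
      replace u with v by ring end end. exact H1.
Qed.

(** Coordinates of the point [- i sg^2 + (r / sg) exp (i pi/6)]. The scaling by [sg] makes the
    quadratic term of the exponent independent of [sg]. *)
Definition line_re (sg r : R) : R := hsqrt3 * r / sg.
Definition line_im (sg r : R) : R := - sg ^ 2 + r / (2 * sg).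

(** The linear term vanishes at the saddle point and the constant one is [2 i sg^6 / 3]. The
    quadratic term is [i exp (i pi/3) r^2 = (- hsqrt3 + i/2) r^2], and the cubic one is
    [- i r^3 / (3 sg^3)] because [exp (i pi/6)] has cube [i]. *)
Lemma airy_on_line (sg r : R) : 0 < sg ->
  airy_re (sg ^ 4) (line_re sg r) (line_im sg r) = - hsqrt3 * r ^ 2 /\
  airy_im (sg ^ 4) (line_re sg r) (line_im sg r)
    = 2 / 3 * sg ^ 6 + r ^ 2 / 2 - r ^ 3 / 3 / sg ^ 3.
Proof.
  intros Hs. assert (H2 := hsqrt3_sqr).
  assert (H3 : hsqrt3 ^ 2 = 3 / 4) by (rewrite <- H2; ring).
  assert (H4 : hsqrt3 ^ 3 = 3 / 4 * hsqrt3) by (rewrite <- H2; ring).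
  unfold airy_re, airy_im, line_re, line_im. split.
  - transitivity (- hsqrt3 ^ 3 * r ^ 3 / sg ^ 3 / 3
      + hsqrt3 * r / sg * (- sg ^ 2 + r / (2 * sg)) ^ 2 - sg ^ 4 * (hsqrt3 * r / sg)).
    + field; lra.
    + rewrite H4. field; lra.
  - transitivity (- (3 * (hsqrt3 ^ 2 * r ^ 2 / sg ^ 2) * (- sg ^ 2 + r / (2 * sg))
       - (- sg ^ 2 + r / (2 * sg)) ^ 3) / 3 - sg ^ 4 * (- sg ^ 2 + r / (2 * sg))).
    + field; lra.
    + rewrite H3. field; lra.
Qed.

Lemma is_derive_line (sg r s : R) :
  0 < sg ->
  is_derive (fun r => line_re sg (s * r)) r (s * (hsqrt3 / sg)) /\
  is_derive (fun r => line_im sg (s * r)) r (s * (/ (2 * sg))).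
Proof. intros Hs. unfold line_re, line_im. split; auto_derive; try lra; field; lra. Qed.

Lemma cos_sin_pi6 : cos (PI / 6) = hsqrt3 /\ sin (PI / 6) = / 2.
Proof. split; [apply cos_PI6|rewrite sin_PI6; lra]. Qed.

(* [s = 1] and [s = -1] are the two halves of the line through the saddle point. *)
Lemma potential_line (sg tau s : R) (Phi : R -> R -> R) :
  0 < sg ->
  airy_potential (sg ^ 4) tau Phi ->
  s = 1 \/ s = -1 ->
  forall r, is_derive (fun r => Phi (line_re sg (s * r)) (line_im sg (s * r))) r
    (s / sg * (exp (- hsqrt3 * r ^ 2) *
       cos (PI / 6 + 2 / 3 * sg ^ 6 + tau + r ^ 2 / 2 + - s * / sg ^ 3 * cubic r))).
Proof.
  intros Hs HPhi Hs1 r. destruct (is_derive_line sg r s Hs) as [DX DY].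
  assert (H := HPhi _ _ r _ _ DX DY). cbv beta in H.
  destruct (airy_on_line sg (s * r) Hs) as [E1 E2]. rewrite E1, E2 in H.
  assert (S2 : s ^ 2 = 1) by (destruct Hs1; subst s; ring).
  assert (S3 : s ^ 3 = s) by (destruct Hs1; subst s; ring).
  rewrite !Rpow_mult_distr, S2, S3, !Rmult_1_l in H.
  match goal with |- is_derive _ _ ?u => match type of H with is_derive _ _ ?v =>
    replace u with v; [exact H|] end end.
  replace (PI / 6 + 2 / 3 * sg ^ 6 + tau + r ^ 2 / 2 + - s * / sg ^ 3 * cubic r)
    with (PI / 6 + (2 / 3 * sg ^ 6 + r ^ 2 / 2 - s * r ^ 3 / 3 / sg ^ 3 + tau))
    by (unfold cubic; field; lra).
  destruct cos_sin_pi6 as [Ec Es]. rewrite (cos_plus (PI / 6)), Ec, Es. field. lra.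
Qed.

Lemma half_line_limit (sg tau s : R) (Phi : R -> R -> R) :
  0 < sg ->
  airy_potential (sg ^ 4) tau Phi ->
  s = 1 \/ s = -1 ->
  is_lim (fun r => Phi (line_re sg (s * r)) (line_im sg (s * r)) - Phi 0 (- sg ^ 2)) p_infty
    (s / sg * improper (fun r => exp (- hsqrt3 * r ^ 2) *
       cos (PI / 6 + 2 / 3 * sg ^ 6 + tau + r ^ 2 / 2 + - s * / sg ^ 3 * cubic r))).
Proof.
  intros Hs HPhi Hs1.
  set (f := fun r => exp (- hsqrt3 * r ^ 2) *
       cos (PI / 6 + 2 / 3 * sg ^ 6 + tau + r ^ 2 / 2 + - s * / sg ^ 3 * cubic r)).
  assert (Cf : forall r, continuous f r).
  { intros r. apply (ex_derive_continuous f). unfold f, cubic. auto_derive. easy. }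
  destruct (gauss_dominated 0) as [B [HB Hd]].
  assert (Bf : forall r, 0 <= r -> Rabs (f r) <= B * exp (- r)).
  { intros r Hr. eapply Rle_trans; [|apply Hd, Hr]. rewrite pow_O, Rmult_1_r.
    unfold f. rewrite Rabs_mult, (Rabs_pos_eq (exp _)) by (left; apply exp_pos).
    rewrite <- (Rmult_1_r (exp _)) at 2. apply Rmult_le_compat_l; [left; apply exp_pos|].
    apply Rabs_le, COS_bound. }
  destruct (improper_correct f B Cf Bf) as [Hl _].
  apply (is_lim_ext (fun R0 => s / sg * RInt f 0 R0)).
  - intros R0.
    assert (Hi := is_RInt_derive (fun r => Phi (line_re sg (s * r)) (line_im sg (s * r)))
      (fun r => s / sg * f r) 0 R0).
    assert (E := is_RInt_unique _ _ _ _ (Hi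
      (fun r _ => potential_line sg tau s Phi Hs HPhi Hs1 r)
      (fun r _ => continuous_mult (fun _ => s / sg) f r (continuous_const _ _) (Cf r)))).
    cbv beta in E. rewrite Rmult_0_r in E.
    assert (E0 : line_re sg 0 = 0) by (unfold line_re; field; lra).
    assert (E1 : line_im sg 0 = - sg ^ 2) by (unfold line_im; field; lra).
    rewrite E0, E1 in E.
    transitivity (RInt (fun r => scal (s / sg) (f r)) 0 R0); [|exact E].
    symmetry. exact (RInt_scal f 0 R0 (s / sg) (continuous_ex_RInt f 0 R0 Cf)).
  - apply (is_lim_scal_l (fun R0 => RInt f 0 R0) (s / sg) p_infty (improper f)). exact Hl.
Qed.

(* The connecting segments at infinity between the original contour and the slanted line. *)
Lemma vertical_segment_bound (sg tau rho : R) (Phi : R -> R -> R) :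
  0 < sg -> airy_potential (sg ^ 4) tau Phi -> sg ^ 2 <= rho / 2 ->
  Rabs (Phi (hsqrt3 * rho) (- sg ^ 2 + rho / 2) - Phi (hsqrt3 * rho) 0)
    <= rho * exp (- hsqrt3 * sg ^ 2 * rho ^ 2).
Proof.
  intros Hs HPhi Hrho. assert (Hp := hsqrt3_pos). assert (H2 := hsqrt3_sqr).
  assert (Hs2 : 0 < sg ^ 2) by (apply pow_lt; lra).
  set (T := hsqrt3 * rho). set (y1 := - sg ^ 2 + rho / 2).
  assert (Hy1 : 0 <= y1) by (unfold y1; lra).
  set (M := exp (- hsqrt3 * sg ^ 2 * rho ^ 2)).
  assert (HM : 0 < M) by apply exp_pos.
  assert (I := increment_le (Phi T) (fun y => M * y)
    (fun y => exp (airy_re (sg ^ 4) T y) *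
        (cos (airy_im (sg ^ 4) T y + tau) * 0 - sin (airy_im (sg ^ 4) T y + tau) * 1))
    (fun _ => M) 0 y1 Hy1).
  apply Rle_trans with (M * y1 - M * 0).
  - apply I; clear I.
    + intros y _. apply (HPhi (fun _ => T) (fun y => y)).
      * apply (is_derive_const (V := R_NormedModule)).
      * apply (is_derive_id (K := R_AbsRing)).
    + intros y _. auto_derive; [easy|ring].
    + intros y Hy. rewrite Rabs_mult, Rabs_pos_eq by (left; apply exp_pos).
      rewrite <- (Rmult_1_r M).
      apply Rmult_le_compat; [left; apply exp_pos|apply Rabs_pos| |].
      (* The exponent is largest at the upper end [y1] of the segment. There the terms cubic in
         [rho] cancel because [hsqrt3^2 = 3/4], and the quadratic decay remains. *)
      * assert (HA : airy_re (sg ^ 4) T y <= - hsqrt3 * sg ^ 2 * rho ^ 2).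
        { assert (HT : 0 <= T) by (unfold T; apply Rmult_le_pos; lra).
          assert (y ^ 2 <= y1 ^ 2) by (apply pow_incr; lra).
          assert (airy_re (sg ^ 4) T y <= T * y1 ^ 2 - T ^ 3 / 3 - sg ^ 4 * T)
            by (unfold airy_re; nra).
          replace (T * y1 ^ 2 - T ^ 3 / 3 - sg ^ 4 * T)
            with (- hsqrt3 * sg ^ 2 * rho ^ 2 + T * rho ^ 2 / 3 * (3 / 4 - hsqrt3 * hsqrt3))
            in H0 by (unfold T, y1; field).
          rewrite H2 in H0. lra. }
        destruct HA as [HA|HA]; [left; now apply exp_increasing|rewrite HA; unfold M; lra].
      * rewrite Rmult_0_r, Rminus_0_l, Rmult_1_r, Rabs_Ropp.
        apply Rabs_le, SIN_bound.
  - unfold y1. nra.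
Qed.

(* Jordan's lemma: the exponent is at most linear along the segment. *)
Lemma horizontal_segment_bound (sg tau T : R) (Phi : R -> R -> R) :
  0 < sg -> airy_potential (sg ^ 4) tau Phi -> sg ^ 2 < T ->
  Rabs (Phi 0 (- T) - Phi (- (hsqrt3 * (2 * (T - sg ^ 2)))) (- T))
    <= / (2 * sg ^ 2 * (T - sg ^ 2)).
Proof.
  intros Hs HPhi HT. assert (Hp := hsqrt3_pos). assert (H2 := hsqrt3_sqr).
  assert (Hs2 : 0 < sg ^ 2) by (apply pow_lt; lra).
  set (X1 := hsqrt3 * (2 * (T - sg ^ 2))).
  assert (HX1 : 0 <= X1) by (unfold X1; apply Rmult_le_pos; lra).
  (* [k] is the slope of the chord of the exponent between its ends [- X1] and [0]. The exponent is
     a convex cubic for [x <= 0], hence lies below this chord. *)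
  set (k := 2 * sg ^ 2 * (T - sg ^ 2)).
  assert (Hk : 0 < k) by (unfold k; apply Rmult_lt_0_compat; lra).
  assert (I := increment_le (fun x => Phi x (- T)) (fun x => / k * exp (k * x))
    (fun x => exp (airy_re (sg ^ 4) x (- T)) *
        (cos (airy_im (sg ^ 4) x (- T) + tau) * 1 - sin (airy_im (sg ^ 4) x (- T) + tau) * 0))
    (fun x => exp (k * x)) (- X1) 0 (ltac:(lra))).
  apply Rle_trans with (/ k * exp (k * 0) - / k * exp (k * - X1)).
  - apply I; clear I.
    + intros x _. apply (HPhi (fun x => x) (fun _ => - T)).
      * apply (is_derive_id (K := R_AbsRing)).
      * apply (is_derive_const (V := R_NormedModule)).
    + intros x _. auto_derive; [easy|field; lra].
    + intros x Hx. rewrite Rabs_mult, Rabs_pos_eq by (left; apply exp_pos).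
      rewrite <- (Rmult_1_r (exp (k * x))).
      apply Rmult_le_compat; [left; apply exp_pos|apply Rabs_pos| |].
      * assert (HA : airy_re (sg ^ 4) x (- T) <= k * x).
        { assert (HX : X1 ^ 2 = 3 * (T - sg ^ 2) ^ 2).
          { unfold X1. transitivity (hsqrt3 * hsqrt3 * (2 * (T - sg ^ 2)) ^ 2); [ring|].
            rewrite H2. field. }
          assert (x ^ 2 <= X1 ^ 2).
          { replace (x ^ 2) with ((- x) ^ 2) by ring. apply pow_incr. lra. }
          assert (0 <= - x * (X1 ^ 2 - x ^ 2)) by (apply Rmult_le_pos; lra).
          replace (airy_re (sg ^ 4) x (- T)) with
            (k * x + - (- x * (3 * (T - sg ^ 2) ^ 2 - x ^ 2)) / 3)
            by (unfold airy_re, k; field).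
          rewrite HX in H0. lra. }
        destruct HA as [HA|HA]; [left; now apply exp_increasing|rewrite HA; lra].
      * rewrite Rmult_0_r, Rminus_0_r, Rmult_1_r. apply Rabs_le, COS_bound.
  - rewrite Rmult_0_r, exp_0. assert (0 < / k) by now apply Rinv_0_lt_compat.
    assert (He := exp_pos (k * - X1)). nra.
Qed.

Lemma saddle_correct (t : R -> R) (e : R) :
  (forall r, continuous t r) -> (forall r, Rabs (t r) <= 1) ->
  is_lim (fun T => RInt (fun r => exp (- hsqrt3 * r ^ 2) * t r * cos (0 + e * cubic r)) 0 T)
    p_infty (saddle t e).
Proof.
  intros Ht Ht1. destruct saddle_smooth as [B [HB Hsm]].
  destruct (Hsm t Ht Ht1) as [Hd _].
  apply (improper_correct (fun r => exp (- hsqrt3 * r ^ 2) * t r * cos (0 + e * cubic r)) B).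
  - intros x. apply (continuous_osc_integrand (fun r => exp (- hsqrt3 * r ^ 2) * t r)).
    + intros; now apply continuous_gauss_weight.
    + apply continuous_cubic.
  - intros r Hr. apply (osc_integrand_bound (fun r => exp (- hsqrt3 * r ^ 2) * t r)).
    now apply Hd.
Qed.

(** The two halves of the line carry opposite signs of [e], so the part odd in [e] cancels and the
    cubic phase survives only through [cos (e * cubic r)]. This is why [K] needs just the two
    integrals [saddle]. *)
Lemma two_halves (th e : R) :
  improper (fun r => exp (- hsqrt3 * r ^ 2) * cos (th + r ^ 2 / 2 + - e * cubic r))
  + improper (fun r => exp (- hsqrt3 * r ^ 2) * cos (th + r ^ 2 / 2 + e * cubic r))
  = 2 * (cos th * saddle (fun r => cos (r ^ 2 / 2)) e
         - sin th * saddle (fun r => sin (r ^ 2 / 2)) e).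
Proof.
  set (f := fun e r => exp (- hsqrt3 * r ^ 2) * cos (th + r ^ 2 / 2 + e * cubic r)).
  change (improper (f (- e)) + improper (f e)
    = 2 * (cos th * saddle (fun r => cos (r ^ 2 / 2)) e
           - sin th * saddle (fun r => sin (r ^ 2 / 2)) e)).
  assert (Cf : forall e r, continuous (f e) r).
  { intros d r. apply (ex_derive_continuous (f d)). unfold f, cubic. auto_derive. easy. }
  destruct (gauss_dominated 0) as [B [HB Hd]].
  assert (Bf : forall e r, 0 <= r -> Rabs (f e r) <= B * exp (- r)).
  { intros d r Hr. eapply Rle_trans; [|apply Hd, Hr]. rewrite pow_O.
    unfold f. rewrite Rabs_mult, (Rabs_pos_eq (exp _)) by (left; apply exp_pos).
    apply Rmult_le_compat_l; [left; apply exp_pos|]. apply Rabs_le, COS_bound. }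
  destruct (improper_correct _ B (Cf (- e)) (Bf (- e))) as [L1 _].
  destruct (improper_correct _ B (Cf e) (Bf e)) as [L2 _].
  destruct half_sqr_trig_continuous as [Cc Cs].
  assert (Lc := saddle_correct (fun r => cos (r ^ 2 / 2)) e Cc
    (fun r => Rabs_le _ _ (COS_bound (r ^ 2 / 2)))).
  assert (Ls := saddle_correct (fun r => sin (r ^ 2 / 2)) e Cs
    (fun r => Rabs_le _ _ (SIN_bound (r ^ 2 / 2)))).
  assert (La := is_lim_RInt_comb _ _ 1 1 _ _ (Cf (- e)) (Cf e) L1 L2).
  assert (Lb := is_lim_RInt_comb _ _ (2 * cos th) (- (2 * sin th)) _ _
    (fun x => continuous_osc_integrand _ cubic 0 e x
       (fun r => continuous_gauss_weight _ r Cc) continuous_cubic)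
    (fun x => continuous_osc_integrand _ cubic 0 e x
       (fun r => continuous_gauss_weight _ r Cs) continuous_cubic) Lc Ls).
  assert (E : forall T,
    RInt (fun r => 1 * f (- e) r + 1 * f e r) 0 T =
    RInt (fun r => 2 * cos th * (exp (- hsqrt3 * r ^ 2) * cos (r ^ 2 / 2) * cos (0 + e * cubic r))
      + - (2 * sin th) * (exp (- hsqrt3 * r ^ 2) * sin (r ^ 2 / 2) * cos (0 + e * cubic r))) 0 T).
  { intros T. apply RInt_ext. intros x _. unfold f. rewrite Rplus_0_l.
    rewrite (cos_plus (th + x ^ 2 / 2)), (cos_plus (th + x ^ 2 / 2) (e * _)), (cos_plus th).
    replace (- e * cubic x) with (- (e * cubic x)) by ring. rewrite cos_neg, sin_neg.
    simpl. ring. }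
  apply (is_lim_ext _ _ _ _ E) in La.
  apply is_lim_unique in La. apply is_lim_unique in Lb. cbv beta in La, Lb.
  assert (F := f_equal real (eq_trans (eq_sym La) Lb)). cbn [real] in F. lra.
Qed.

Lemma is_lim_at_infinity (u : R -> R) (l : R) (v : R -> R) :
  is_lim u p_infty l -> is_lim v p_infty p_infty -> is_lim (fun T => u (v T)) p_infty l.
Proof.
  intros Hu Hv. apply (is_lim_comp u v p_infty l p_infty Hu Hv).
  apply filter_forall. easy.
Qed.

Lemma is_lim_affine (a b : R) : 0 < a -> is_lim (fun T => a * (T - b)) p_infty p_infty.
Proof.
  intros Ha. apply is_lim_spec. intros M. exists (M / a + b). intros x Hx.
  apply Rmult_lt_reg_r with (/ a); [now apply Rinv_0_lt_compat|].
  replace (a * (x - b) * / a) with (x - b) by (field; lra).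
  unfold Rdiv in Hx. lra.
Qed.

Lemma is_lim_zero_of_bound (u : R -> R) (c M : R) :
  (forall T, M < T -> Rabs (u T) <= c / (T - M)) -> is_lim u p_infty 0.
Proof.
  intros Hu. apply is_lim_spec. intros eps. simpl.
  exists (Rmax M (M + (Rabs c + 1) / eps)). intros T HT.
  assert (He := cond_pos eps).
  assert (H1 := Rmax_l M (M + (Rabs c + 1) / eps)).
  assert (H2 := Rmax_r M (M + (Rabs c + 1) / eps)).
  rewrite Rminus_0_r. eapply Rle_lt_trans; [apply Hu; lra|].
  assert (H3 : (Rabs c + 1) / eps < T - M) by lra.
  assert (H4 := Rle_abs c).
  apply Rmult_lt_reg_r with (T - M); [lra|].
  replace (c / (T - M) * (T - M)) with c by (field; lra).
  apply (Rmult_lt_compat_r eps) in H3; [|lra].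
  replace ((Rabs c + 1) / eps * eps) with (Rabs c + 1) in H3 by (field; lra). lra.
Qed.

(** The path from [- i T] up to the origin and on to [T] along the real axis has the same ends as
    the path through the saddle line closed by one horizontal and one vertical segment.
    Single-valuedness of [Phi] equates the two, and both segments vanish in the limit. *)
Lemma airy_contour (sg tau : R) (Phi : R -> R -> R) :
  0 < sg -> airy_potential (sg ^ 4) tau Phi ->
  is_lim (fun T => Phi T 0 - Phi 0 (- T)) p_infty
    (2 / sg * (cos (PI / 6 + 2 / 3 * sg ^ 6 + tau) * saddle (fun r => cos (r ^ 2 / 2)) (/ sg ^ 3)
       - sin (PI / 6 + 2 / 3 * sg ^ 6 + tau) * saddle (fun r => sin (r ^ 2 / 2)) (/ sg ^ 3))).
Proof.
  intros Hs HPhi. assert (Hp := hsqrt3_pos).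
  assert (Hs2 : 0 < sg ^ 2) by (apply pow_lt; lra).
  assert (P1 := half_line_limit sg tau 1 Phi Hs HPhi (or_introl eq_refl)).
  assert (P2 := half_line_limit sg tau (-1) Phi Hs HPhi (or_intror eq_refl)).
  (* These parameters cut the line where its real part is [T] and where its imaginary part is [- T],
     so that the connecting segments are exactly vertical and horizontal. *)
  apply (is_lim_at_infinity _ _ (fun T => sg / hsqrt3 * (T - 0))) in P1;
    [|apply is_lim_affine, Rdiv_lt_0_compat; lra].
  apply (is_lim_at_infinity _ _ (fun T => 2 * sg * (T - sg ^ 2))) in P2;
    [|apply is_lim_affine; lra].
  assert (Z1 : is_lim (fun T => Phi (hsqrt3 * (T / hsqrt3)) (- sg ^ 2 + T / hsqrt3 / 2)
                 - Phi (hsqrt3 * (T / hsqrt3)) 0) p_infty 0).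
  { apply is_lim_zero_of_bound with (/ sg ^ 2) (2 * hsqrt3 * sg ^ 2).
    intros T HT. assert (Hrho : 2 * sg ^ 2 <= T / hsqrt3).
    { apply Rmult_le_reg_r with hsqrt3; [lra|].
      replace (T / hsqrt3 * hsqrt3) with T by (field; lra). lra. }
    eapply Rle_trans; [apply (vertical_segment_bound sg tau); auto; lra|].
    set (rho := T / hsqrt3) in *.
    assert (HT' : T = hsqrt3 * rho) by (unfold rho; field; lra).
    set (w := hsqrt3 * sg ^ 2 * rho ^ 2).
    assert (Hw : 0 < w) by (unfold w; apply Rmult_lt_0_compat;
          [apply Rmult_lt_0_compat; lra|apply pow_lt; lra]).
    replace (- hsqrt3 * sg ^ 2 * rho ^ 2) with (- w) by (unfold w; ring).
    assert (E1 : exp (- w) <= / w).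
    { rewrite exp_Ropp. apply Rinv_le_contravar; [lra|]. generalize (exp_ineq1 w). lra. }
    apply Rle_trans with (rho * / w); [apply Rmult_le_compat_l; lra|].
    replace (rho * / w) with (/ sg ^ 2 * / T) by (unfold w; rewrite HT'; field; lra).
    unfold Rdiv. apply Rmult_le_compat_l; [left; now apply Rinv_0_lt_compat|].
    assert (0 < hsqrt3 * sg ^ 2) by (apply Rmult_lt_0_compat; lra).
    apply Rinv_le_contravar; lra. }
  assert (Z2 : is_lim (fun T => Phi 0 (- T) - Phi (- (hsqrt3 * (2 * (T - sg ^ 2)))) (- T))
                 p_infty 0).
  { apply is_lim_zero_of_bound with (/ (2 * sg ^ 2)) (sg ^ 2).
    intros T HT. eapply Rle_trans; [apply (horizontal_segment_bound sg tau); auto|].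
    right. field. lra. }
  assert (L := is_lim_minus' _ _ _ _ _
    (is_lim_minus' _ _ _ _ _ (is_lim_minus' _ _ _ _ _ P1 P2) Z1) Z2).
  match type of L with is_lim _ _ (Finite ?l) =>
    match goal with |- is_lim _ _ (Finite ?r) => replace r with l end end.
  - eapply is_lim_ext; [|exact L]. intros T. cbv beta.
    replace (line_re sg (1 * (sg / hsqrt3 * (T - 0)))) with T by (unfold line_re; field; lra).
    replace (line_im sg (1 * (sg / hsqrt3 * (T - 0)))) with (- sg ^ 2 + T / hsqrt3 / 2)
      by (unfold line_im; field; lra).
    replace (line_re sg (-1 * (2 * sg * (T - sg ^ 2))))
      with (- (hsqrt3 * (2 * (T - sg ^ 2)))) by (unfold line_re; field; lra).
    replace (line_im sg (-1 * (2 * sg * (T - sg ^ 2)))) with (- T)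
      by (unfold line_im; field; lra).
    replace (hsqrt3 * (T / hsqrt3)) with T by (field; lra). ring.
  - assert (E := two_halves (PI / 6 + 2 / 3 * sg ^ 6 + tau) (/ sg ^ 3)).
    replace (-1 * / sg ^ 3) with (- / sg ^ 3) by ring.
    replace (- (1) * / sg ^ 3) with (- / sg ^ 3) by ring.
    replace (- (-1) * / sg ^ 3) with (/ sg ^ 3) by ring.
    rewrite !Rminus_0_r.
    transitivity (/ sg * (2 * (cos (PI / 6 + 2 / 3 * sg ^ 6 + tau) *
        saddle (fun r => cos (r ^ 2 / 2)) (/ sg ^ 3)
       - sin (PI / 6 + 2 / 3 * sg ^ 6 + tau) * saddle (fun r => sin (r ^ 2 / 2)) (/ sg ^ 3)))).
    + rewrite <- E. field. lra.
    + field. lra.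
Qed.

Lemma RInt_of_derive (Psi f : R -> R) (T : R) :
  (forall t, is_derive Psi t (f t)) -> (forall t, ex_derive f t) ->
  RInt f 0 T = Psi T - Psi 0.
Proof.
  intros D C. apply is_RInt_unique. apply (is_RInt_derive Psi f 0 T).
  - intros; apply D.
  - intros; now apply (ex_derive_continuous f).
Qed.

(** On the contour the real axis contributes the exponential in [Bi] and the imaginary axis
    contributes [sin + i cos], so the contour integral is [PI * (Bi + i Ai)]. The shift [tau = 0]
    extracts its real part, and [tau = - PI / 2] its imaginary part. *)
Lemma airy_values (sg : R) : 0 < sg ->
  let th := PI / 6 + 2 / 3 * sg ^ 6 in
  let kc := saddle (fun r => cos (r ^ 2 / 2)) (/ sg ^ 3) in
  let ks := saddle (fun r => sin (r ^ 2 / 2)) (/ sg ^ 3) in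
  Bi (- sg ^ 4) = / PI * (2 / sg * (cos th * kc - sin th * ks)) /\
  Ai (- sg ^ 4) = / PI * (2 / sg * (sin th * kc + cos th * ks)).
Proof.
  intros Hs th kc ks. split.
  - destruct (airy_potential_exists (sg ^ 4) 0) as [Phi HPhi].
    assert (L := airy_contour sg 0 Phi Hs HPhi). rewrite Rplus_0_r in L.
    unfold Bi. f_equal. fold th kc ks in L.
    change (2 / sg * (cos th * kc - sin th * ks))
      with (real (2 / sg * (cos th * kc - sin th * ks))). f_equal.
    rewrite <- (is_lim_unique _ _ _ L). apply Lim_ext. intros T.
    set (Psi := fun t => Phi t 0 - Phi 0 (- t)).
    assert (D : forall t, is_derive Psi t
      (exp (- t ^ 3 / 3 + - sg ^ 4 * t) + sin (t ^ 3 / 3 + - sg ^ 4 * t))).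
    { intros t.
      assert (D1 := HPhi (fun t => t) (fun _ => 0) t 1 0
        (is_derive_id (K := R_AbsRing) t) (is_derive_const (V := R_NormedModule) 0 t)).
      assert (Dn : is_derive (fun t => - t) t (-1)) by (auto_derive; [easy|ring]).
      assert (D2 := HPhi (fun _ => 0) (fun t => - t) t 0 (-1)
        (is_derive_const (V := R_NormedModule) 0 t) Dn).
      assert (D3 := is_derive_minus _ _ _ _ _ D1 D2). cbv beta in D3.
      match goal with |- is_derive _ _ ?u => match type of D3 with is_derive _ _ ?v =>
        replace u with v; [exact D3|] end end.
      replace (airy_re (sg ^ 4) t 0) with (- t ^ 3 / 3 + - sg ^ 4 * t)
        by (unfold airy_re; field).
      replace (airy_im (sg ^ 4) t 0 + 0) with 0 by (unfold airy_im; field).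
      replace (airy_re (sg ^ 4) 0 (- t)) with 0 by (unfold airy_re; field).
      replace (airy_im (sg ^ 4) 0 (- t) + 0) with (- (t ^ 3 / 3 + - sg ^ 4 * t))
        by (unfold airy_im; field).
      rewrite exp_0, cos_0, sin_0, sin_neg. unfold minus, plus, opp; simpl. ring. }
    symmetry. etransitivity; [apply (RInt_of_derive Psi _ T D); intros; auto_derive; easy|].
    unfold Psi. rewrite Ropp_0. ring.
  - destruct (airy_potential_exists (sg ^ 4) (- (PI / 2))) as [Phi HPhi].
    assert (L := airy_contour sg (- (PI / 2)) Phi Hs HPhi).
    fold th kc ks in L.
    assert (Ec : cos (th + - (PI / 2)) = sin th).
    { rewrite cos_plus, cos_neg, sin_neg, cos_PI2, sin_PI2. ring. }
    assert (Es : sin (th + - (PI / 2)) = - cos th).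
    { rewrite sin_plus, cos_neg, sin_neg, cos_PI2, sin_PI2. ring. }
    rewrite Ec, Es in L.
    replace (sin th * kc + cos th * ks) with (sin th * kc - - cos th * ks) by ring.
    unfold Ai. f_equal.
    change (2 / sg * (sin th * kc - - cos th * ks))
      with (real (2 / sg * (sin th * kc - - cos th * ks))). f_equal.
    rewrite <- (is_lim_unique _ _ _ L). apply Lim_ext. intros T.
    set (Psi := fun t => Phi t 0 - Phi 0 (- t)).
    assert (D : forall t, is_derive Psi t (cos (t ^ 3 / 3 + - sg ^ 4 * t))).
    { intros t.
      assert (D1 := HPhi (fun t => t) (fun _ => 0) t 1 0
        (is_derive_id (K := R_AbsRing) t) (is_derive_const (V := R_NormedModule) 0 t)).
      assert (Dn : is_derive (fun t => - t) t (-1)) by (auto_derive; [easy|ring]).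
      assert (D2 := HPhi (fun _ => 0) (fun t => - t) t 0 (-1)
        (is_derive_const (V := R_NormedModule) 0 t) Dn).
      assert (D3 := is_derive_minus _ _ _ _ _ D1 D2). cbv beta in D3.
      match goal with |- is_derive _ _ ?u => match type of D3 with is_derive _ _ ?v =>
        replace u with v; [exact D3|] end end.
      replace (airy_im (sg ^ 4) t 0 + - (PI / 2)) with (- (PI / 2)) by (unfold airy_im; field).
      replace (airy_re (sg ^ 4) 0 (- t)) with 0 by (unfold airy_re; field).
      replace (airy_im (sg ^ 4) 0 (- t)) with (- (t ^ 3 / 3 + - sg ^ 4 * t))
        by (unfold airy_im; field).
      rewrite (sin_plus (- (t ^ 3 / 3 + _))), !cos_neg, !sin_neg, cos_PI2, sin_PI2, exp_0.
      unfold minus, plus, opp; simpl. ring. }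
    symmetry. etransitivity; [apply (RInt_of_derive Psi _ T D); intros; auto_derive; easy|].
    unfold Psi. rewrite Ropp_0. ring.
Qed.

(** * Asymptotics of the phase *)

Lemma cbrtF_cube (F : R) : 0 < F -> 0 < cbrtF F /\ cbrtF F ^ 3 = F.
Proof.
  intros HF. unfold cbrtF. split; [apply exp_pos|].
  rewrite <- Rpower_pow by apply exp_pos. rewrite Rpower_mult.
  replace (1 / 3 * INR 3) with 1 by (simpl; lra). now apply Rpower_1.
Qed.

Definition fourth_root (z : R) : R := Rpower z (1 / 4).

Lemma fourth_root_correct (z : R) : 0 < z ->
  0 < fourth_root z /\ fourth_root z ^ 4 = z /\
  is_derive fourth_root z (/ (4 * fourth_root z ^ 3)).
Proof.
  intros Hz. unfold fourth_root.
  assert (Hp : 0 < Rpower z (1 / 4)) by apply exp_pos.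
  assert (H4 : Rpower z (1 / 4) ^ 4 = z).
  { rewrite <- Rpower_pow by exact Hp. rewrite Rpower_mult.
    replace (1 / 4 * INR 4) with 1 by (simpl; lra). now apply Rpower_1. }
  split; [exact Hp|]. split; [exact H4|].
  replace (/ (4 * Rpower z (1 / 4) ^ 3)) with (1 / 4 * (/ z * Rpower z (1 / 4))).
  - unfold Rpower. auto_derive; [easy|]. field. lra.
  - rewrite <- H4 at 1. field. lra.
Qed.

(** [D] takes values in the multiples of [2 * PI]; values closer than 1 to each other must
    coincide. *)
Lemma cos_sin_locally_unique (D : R -> R) (x : R) :
  continuous D x -> locally x (fun y => cos (D y) = 1 /\ sin (D y) = 0) ->
  locally x (fun y => D y = D x).
Proof.
  intros HD HL.
  assert (Hx := locally_singleton _ _ HL). destruct Hx as [Cx Sx].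
  assert (HB := HD _ (locally_ball (D x) (mkposreal 1 Rlt_0_1))).
  generalize (filter_and _ _ HL HB). apply filter_imp. intros y [[Cy Sy] By].
  change (Rabs (D y - D x) < 1) in By. apply Rabs_lt_between in By.
  assert (S0 : sin (D y - D x) = 0) by (rewrite sin_minus, Sy, Sx; ring).
  assert (P := PI2_1).
  destruct (Rtotal_order (D y) (D x)) as [H|[H|H]]; [|exact H|].
  - assert (0 < sin (- (D y - D x))) by (apply sin_gt_0; lra). rewrite sin_neg in H0. lra.
  - assert (0 < sin (D y - D x)) by (apply sin_gt_0; lra). lra.
Qed.

(** The phase is given only as a continuous function. Its differentiability is inherited from any
    explicit phase, from which it differs by a locally constant multiple of [2 * PI]. *)
Lemma is_derive_phase_locally (g phi : R -> R) (x d : R) :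
  continuous g x ->
  locally x (fun y => cos (g y) = cos (phi y) /\ sin (g y) = sin (phi y)) ->
  is_derive phi x d -> is_derive g x d.
Proof.
  intros Hg HL Hphi.
  assert (Hc : continuous (fun y => g y - phi y) x).
  { apply (continuous_minus g phi); [exact Hg|].
    apply (ex_derive_continuous phi). now exists d. }
  assert (HD : locally x (fun y => g y - phi y = g x - phi x)).
  { apply (cos_sin_locally_unique (fun y => g y - phi y)); [exact Hc|].
    revert HL. apply filter_imp. intros y [C S].
    rewrite cos_minus, sin_minus, C, S. generalize (sin2_cos2 (phi y)). unfold Rsqr.
    intros; split; lra. }
  apply (is_derive_ext_loc (fun y => phi y + (g x - phi x))).
  - revert HD. apply filter_imp. intros y Hy. lra.
  - replace d with (plus d 0) by (unfold plus; simpl; ring).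
    apply (is_derive_plus phi (fun _ => g x - phi x)); [exact Hphi|].
    apply (is_derive_const (V := R_NormedModule)).
Qed.

Lemma polar_unique (r t t' : R) : 0 < r ->
  (r * cos t, r * sin t) = Cmult (RtoC (Cmod (r * cos t, r * sin t))) (cos t', sin t') ->
  cos t' = cos t /\ sin t' = sin t.
Proof.
  intros Hr H.
  assert (Hm : Cmod (r * cos t, r * sin t) = r).
  { unfold Cmod; simpl fst; simpl snd.
    replace ((r * cos t) ^ 2 + (r * sin t) ^ 2) with (r ^ 2 * (Rsqr (sin t) + Rsqr (cos t)))
      by (unfold Rsqr; ring).
    rewrite sin2_cos2, Rmult_1_r. apply sqrt_pow2. lra. }
  rewrite Hm in H. unfold Cmult, RtoC in H. simpl in H. injection H. intros H1 H2.
  split; apply Rmult_eq_reg_l with r; lra.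
Qed.

Lemma zeta_polar (q : R -> R) (F E s x : R) :
  0 < F -> 0 < s -> cbrtF F * (x + E / F) = s ^ 4 ->
  (exists rho, 0 < rho /\
      saddle (fun r => cos (r ^ 2 / 2)) (/ s ^ 3) = rho * cos (q (/ s ^ 3)) /\
      saddle (fun r => sin (r ^ 2 / 2)) (/ s ^ 3) = rho * sin (q (/ s ^ 3))) ->
  exists r, 0 < r /\
    zeta F E x = (r * cos (PI / 6 + 2 / 3 * s ^ 6 + q (/ s ^ 3)),
                  r * sin (PI / 6 + 2 / 3 * s ^ 6 + q (/ s ^ 3))).
Proof.
  intros HF Hs Hx [rho [Hrho [Ec Es]]].
  destruct (cbrtF_cube F HF) as [Hk _].
  assert (HP := PI_RGT_0).
  exists (sqrt (PI / cbrtF F) * (/ PI * (2 / s * rho))). split.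
  - apply Rmult_lt_0_compat; [apply sqrt_lt_R0, Rdiv_lt_0_compat; lra|].
    apply Rmult_lt_0_compat; [now apply Rinv_0_lt_compat|].
    apply Rmult_lt_0_compat; [apply Rdiv_lt_0_compat; lra|lra].
  - unfold zeta. rewrite Hx. destruct (airy_values s Hs) as [HB HA].
    rewrite HB, HA, Ec, Es. unfold Cmult, RtoC. cbn [fst snd].
    rewrite (cos_plus _ (q _)), (sin_plus _ (q _)). f_equal; ring.
Qed.

(** In terms of [s] one has [sqrt (F x + E) = k s^2] and [s' = k / (4 s^3)]. The term [2 s^6 / 3]
    alone would give [gamma' = k s^2] and [gamma'' = k^2 / (2 s^2)]; the stated bounds leave a
    factor of two on either side for the contribution of [q]. *)
Lemma phase_asymptotics (F E : R) (g : R -> R) :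
  0 < F -> is_phase_of_zeta F E g ->
  exists (X0 : R) (g1 g2 : R -> R), forall x, X0 < x ->
    0 < F * x + E /\ is_derive g x (g1 x) /\ is_derive g1 x (g2 x) /\
    sqrt (F * x + E) / 2 <= g1 x /\
    F / (4 * sqrt (F * x + E)) <= g2 x <= F / sqrt (F * x + E).
Proof.
  intros HF [Hg [Hz _]].
  destruct (cbrtF_cube F HF) as [Hk Hk3]. set (k := cbrtF F) in *.
  destruct saddle_phase as [B [e0 [q [q1 [q2 [HB [He0 Hq]]]]]]].
  (* The summands serve in turn: [s >= 1], so that higher negative powers of [s] are at most
     [1 / s]; corrections below the allowed margins, the tightest being
     [(21/16 + 9/16) * B / s <= 1/4]; and [s^(-3) < e0]. *)
  set (S := 1 + 8 * B + / e0).
  assert (Hie := Rinv_0_lt_compat _ He0).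
  set (s := fun x => fourth_root (k * (x + E / F))).
  set (phi := fun x => PI / 6 + 2 / 3 * s x ^ 6 + q (/ s x ^ 3)).
  set (g1 := fun x => k * (s x ^ 2 - 3 / 4 * q1 (/ s x ^ 3) / s x ^ 7)).
  set (g2 := fun x => k ^ 2 * (/ (2 * s x ^ 2) + 21 / 16 * q1 (/ s x ^ 3) / s x ^ 11
                                 + 9 / 16 * q2 (/ s x ^ 3) / s x ^ 14)).
  exists (S ^ 4 / k - E / F), g1, g2.
  assert (Hs : forall x, S ^ 4 / k - E / F < x ->
    S < s x /\ s x ^ 4 = k * (x + E / F) /\ is_derive s x (k / (4 * s x ^ 3))).
  { intros x Hx.
    assert (HS : 0 < S) by (unfold S; lra).
    assert (Hz4 : S ^ 4 < k * (x + E / F)).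
    { apply Rmult_lt_reg_r with (/ k); [now apply Rinv_0_lt_compat|].
      replace (k * (x + E / F) * / k) with (x + E / F) by (field; lra).
      unfold Rdiv in *. lra. }
    assert (HS4 : 0 < S ^ 4) by now apply pow_lt.
    destruct (fourth_root_correct (k * (x + E / F)) ltac:(lra)) as [P1 [P2 P3]].
    fold (s x) in P1, P2, P3. split; [|split; [exact P2|]].
    - apply Rnot_le_lt. intros Hc.
      assert (s x ^ 4 <= S ^ 4) by (apply pow_incr; lra). lra.
    - replace (k / (4 * s x ^ 3)) with (scal k (/ (4 * s x ^ 3)))
        by (unfold scal; simpl; unfold mult; simpl; field; lra).
      apply (is_derive_comp fourth_root (fun x => k * (x + E / F))); [exact P3|].
      auto_derive; [easy|ring]. }
  assert (Heps : forall t, S < t -> Rabs (/ t ^ 3) < e0).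
  { intros t Ht. unfold S in Ht.
    assert (Ht3 : t <= t ^ 3) by (assert (1 <= t * t) by nra; simpl; nra).
    rewrite Rabs_pos_eq by (left; apply Rinv_0_lt_compat; lra).
    rewrite <- (Rinv_inv e0). apply Rinv_lt_contravar; [apply Rmult_lt_0_compat; lra|lra]. }
  assert (Hphase : forall x, S ^ 4 / k - E / F < x ->
    cos (g x) = cos (phi x) /\ sin (g x) = sin (phi x)).
  { intros x Hx. destruct (Hs x Hx) as [S1 [S2 _]].
    destruct (Hq _ (Heps _ S1)) as [_ [_ [_ [_ Hrho]]]].
    assert (Hs0 : 0 < s x) by (unfold S in S1; lra).
    destruct (zeta_polar q F E (s x) x HF Hs0 (eq_sym S2) Hrho) as [r [Hr Hzr]].
    specialize (Hz x). rewrite Hzr in Hz. now apply polar_unique with r. }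
  intros x Hx. destruct (Hs x Hx) as [S1 [S2 S3]].
  destruct (Hq _ (Heps _ S1)) as [Q1 [Q2 [B1 [B2 _]]]].
  assert (Hs1 : 1 <= s x) by (unfold S in S1; lra).
  assert (Ex : F * x + E = (k * s x ^ 2) ^ 2).
  { transitivity (k ^ 2 * s x ^ 4); [|ring]. rewrite S2.
    transitivity (k ^ 3 * (x + E / F)); [rewrite Hk3; field; lra|ring]. }
  assert (Hks : 0 < k * s x ^ 2) by (apply Rmult_lt_0_compat; [lra|apply pow_lt; lra]).
  assert (Hsq : sqrt (F * x + E) = k * s x ^ 2) by (rewrite Ex; apply sqrt_pow2; lra).
  rewrite Hsq.
  assert (Hinv : is_derive (fun x => / s x ^ 3) x (- 3 * (k / (4 * s x ^ 3)) / s x ^ 4)).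
  { auto_derive.
    - repeat apply conj; try exact I; [exists (k / (4 * s x ^ 3)); exact S3|].
      apply (pow_nonzero _ 3); lra.
    - replace (Derive (fun x => s x) x) with (k / (4 * s x ^ 3))
        by (symmetry; now apply is_derive_unique).
      field. lra. }
  set (e := fun x => / s x ^ 3) in *.
  assert (Ee : / s x ^ 3 = e x) by reflexivity. rewrite Ee in Q1, Q2, B1, B2.
  assert (Dq := is_derive_comp q e x _ _ Q1 Hinv).
  assert (Dq1 := is_derive_comp q1 e x _ _ Q2 Hinv).
  refine (conj _ (conj _ (conj _ (conj _ _)))).
  - rewrite Ex. apply pow_lt. exact Hks.
  - apply is_derive_phase_locally with phi; [apply Hg| |].
    + apply (filter_imp (fun y => S ^ 4 / k - E / F < y)); [exact Hphase|].
      exact (open_gt _ _ Hx).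
    + assert (D6 : is_derive (fun x => PI / 6 + 2 / 3 * s x ^ 6) x
                     (4 * s x ^ 5 * (k / (4 * s x ^ 3)))).
      { auto_derive; [now exists (k / (4 * s x ^ 3))|].
        replace (Derive (fun x => s x) x) with (k / (4 * s x ^ 3))
          by (symmetry; now apply is_derive_unique). field. lra. }
      assert (D7 := is_derive_plus _ _ _ _ _ D6 Dq).
      match type of D7 with is_derive _ _ ?v => replace (g1 x) with v; [exact D7|] end.
      unfold scal, plus; cbn -[pow]. unfold mult; cbn -[pow]. unfold g1.
      rewrite Ee. field. lra.
  - assert (D2 : is_derive (fun x => s x ^ 2) x (2 * s x * (k / (4 * s x ^ 3)))).
    { auto_derive; [now exists (k / (4 * s x ^ 3))|].
      replace (Derive (fun x => s x) x) with (k / (4 * s x ^ 3))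
        by (symmetry; now apply is_derive_unique). field. lra. }
    assert (D7 : is_derive (fun x => 3 / 4 * / s x ^ 7) x
                   (- (21 / 4) / s x ^ 8 * (k / (4 * s x ^ 3)))).
    { auto_derive.
      - repeat apply conj; try exact I; [exists (k / (4 * s x ^ 3)); exact S3|].
        apply (pow_nonzero _ 7); lra.
      - replace (Derive (fun x => s x) x) with (k / (4 * s x ^ 3))
          by (symmetry; now apply is_derive_unique). field. lra. }
    assert (D8 := is_derive_scal _ _ k _ (is_derive_minus _ _ _ _ _ D2
      (is_derive_mult _ _ _ _ _ D7 Dq1 Rmult_comm))).
    apply (is_derive_ext (fun x => k * (s x ^ 2 - 3 / 4 * / s x ^ 7 * q1 (e x)))).
    + intros y. unfold g1, e, Rdiv. match goal with |- ?l = ?r => change (@eq R l r) end. ring.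
    + match type of D8 with is_derive _ _ ?v => replace (g2 x) with v; [exact D8|] end.
      unfold scal, minus, plus, opp; cbn -[pow]. unfold mult; cbn -[pow].
      unfold g2. rewrite Ee. field. lra.
  - assert (H7 : 3 / 4 * Rabs (q1 (e x)) <= s x ^ 2 / 2 * s x ^ 7).
    { assert (1 <= s x ^ 7) by (apply pow_R1_Rle; lra).
      assert (s x <= s x ^ 2) by nra. unfold S in S1. nra. }
    assert (H7p : 0 < s x ^ 7) by (apply pow_lt; lra).
    assert (Hb := Rle_abs (q1 (e x))).
    unfold g1. rewrite Ee.
    assert (3 / 4 * q1 (e x) / s x ^ 7 <= s x ^ 2 / 2).
    { apply Rmult_le_reg_r with (s x ^ 7); [lra|].
      replace (3 / 4 * q1 (e x) / s x ^ 7 * s x ^ 7) with (3 / 4 * q1 (e x)) by (field; lra).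
      lra. }
    nra.
  - set (d := 21 / 16 * q1 (e x) / s x ^ 9 + 9 / 16 * q2 (e x) / s x ^ 12).
    assert (Hd : Rabs d <= 1 / 4).
    { assert (W : forall n c, Rabs (c / s x ^ (Datatypes.S n)) <= Rabs c / s x).
      { intros n c. unfold Rdiv. rewrite Rabs_mult, Rabs_inv, (Rabs_pos_eq (s x ^ _))
          by (apply pow_le; lra).
        apply Rmult_le_compat_l; [apply Rabs_pos|]. apply Rinv_le_contravar; [lra|].
        assert (1 <= s x ^ n) by (apply pow_R1_Rle; lra). simpl. nra. }
      unfold d. eapply Rle_trans; [apply Rabs_triang|].
      assert (W1 := W 8%nat (21 / 16 * q1 (e x))). assert (W2 := W 11%nat (9 / 16 * q2 (e x))).
      rewrite Rabs_mult, (Rabs_pos_eq (21 / 16)) in W1 by lra.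
      rewrite Rabs_mult, (Rabs_pos_eq (9 / 16)) in W2 by lra.
      assert (W3 : 21 / 16 * Rabs (q1 (e x)) / s x + 9 / 16 * Rabs (q2 (e x)) / s x <= 1 / 4).
      { apply Rmult_le_reg_r with (s x); [lra|].
        match goal with |- ?l <= _ => replace l with
          (21 / 16 * Rabs (q1 (e x)) + 9 / 16 * Rabs (q2 (e x))) by (field; lra) end.
        unfold S in S1. lra. }
      eapply Rle_trans; [apply Rplus_le_compat; [exact W1|exact W2]|exact W3]. }
    apply Rabs_le_between in Hd.
    assert (Eg : g2 x = F / (k * s x ^ 2) * (1 / 2 + d)).
    { unfold g2, d. rewrite Ee. rewrite <- Hk3. field. lra. }
    assert (HFp : 0 < F / (k * s x ^ 2)) by (apply Rdiv_lt_0_compat; lra).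
    rewrite Eg. replace (F / (4 * (k * s x ^ 2))) with (F / (k * s x ^ 2) / 4) by (field; lra).
    split; nra.
Qed.

(** * The second derivative test of van der Corput *)

(** Indexed by first term and length, so that empty blocks and the splitting [csum_app] need no side
    conditions. *)
Fixpoint csum (u : nat -> C) (p m : nat) : C :=
  match m with
  | O => RtoC 0
  | S m' => Cplus (csum u p m') (u (p + m')%nat)
  end.

Definition cis (t : R) : C := (cos t, sin t).

Lemma Cmod_cis t : Cmod (cis t) = 1.
Proof.
  unfold Cmod, cis; cbn [fst snd]. rewrite <- !Rsqr_pow2, Rplus_comm, sin2_cos2.
  apply sqrt_1.
Qed.

Lemma Cmod_le_sum (z : C) : Cmod z <= Rabs (fst z) + Rabs (snd z).
Proof.
  unfold Cmod. rewrite <- (pow2_abs (fst z)), <- (pow2_abs (snd z)).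
  assert (H1 := Rabs_pos (fst z)). assert (H2 := Rabs_pos (snd z)).
  rewrite <- (sqrt_pow2 (Rabs (fst z) + Rabs (snd z))) by lra.
  apply sqrt_le_1_alt. nra.
Qed.

Lemma csum_ext (u v : nat -> C) p m :
  (forall j, (j < m)%nat -> u (p + j)%nat = v (p + j)%nat) -> csum u p m = csum v p m.
Proof.
  induction m as [|m IH]; intros H; simpl; [easy|].
  rewrite IH by (intros; apply H; lia). rewrite H by lia. easy.
Qed.

Lemma csum_app (u : nat -> C) p m1 m2 :
  csum u p (m1 + m2) = Cplus (csum u p m1) (csum u (p + m1) m2).
Proof.
  induction m2 as [|m2 IH].
  - rewrite Nat.add_0_r. simpl. ring.
  - rewrite Nat.add_succ_r. simpl. rewrite IH, Nat.add_assoc. ring.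
Qed.

Lemma csum_trivial_bound (u : nat -> C) p m :
  (forall n, Cmod (u n) <= 1) -> Cmod (csum u p m) <= INR m.
Proof.
  intros H. induction m as [|m IH].
  - simpl. rewrite Cmod_0. lra.
  - rewrite S_INR. simpl csum. eapply Rle_trans; [apply Cmod_triangle|].
    specialize (H (p + m)%nat). lra.
Qed.

(* [T] majorizes the variation of the weights [c]. *)
Lemma abel_summation (a c : nat -> C) (T : nat -> R) (V : R) (p m : nat) :
  (forall j, (j <= S m)%nat -> Cmod (csum a p j) <= V) ->
  (forall j, (j < m)%nat ->
     Cmod (Cminus (c (S (p + j))) (c (p + j)%nat)) <= T (S (p + j)) - T (p + j)%nat) ->
  Cmod (csum (fun n => Cmult (a n) (c n)) p (S m))
    <= V * (Cmod (c (p + m)%nat) + (T (p + m)%nat - T p)).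
Proof.
  intros HA HT.
  assert (HV : 0 <= V) by (eapply Rle_trans; [apply Cmod_ge_0|apply (HA 0%nat); lia]).
  (* The difference between the weighted sum and its boundary term is minus the sum of partial sums
     against increments of [c]; its bound telescopes through [T]. *)
  assert (W : forall m', (m' <= m)%nat ->
    Cmod (Cminus (csum (fun n => Cmult (a n) (c n)) p (S m'))
                 (Cmult (csum a p (S m')) (c (p + m')%nat)))
      <= V * (T (p + m')%nat - T p)).
  { induction m' as [|m' IH]; intros Hm.
    - rewrite Nat.add_0_r. simpl. rewrite Nat.add_0_r.
      replace (Cminus _ _) with (RtoC 0) by ring.
      rewrite Cmod_0. lra.
    - assert (IH' := IH ltac:(lia)). clear IH.
      replace (p + S m')%nat with (S (p + m')) by lia.
      set (X := csum (fun n => Cmult (a n) (c n)) p (S m')) in *.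
      set (Y := csum a p (S m')) in *.
      replace (csum (fun n => Cmult (a n) (c n)) p (S (S m')))
        with (Cplus X (Cmult (a (S (p + m'))) (c (S (p + m')))))
        by (unfold X; simpl; rewrite <- plus_n_Sm; easy).
      replace (csum a p (S (S m'))) with (Cplus Y (a (S (p + m'))))
        by (unfold Y; simpl; rewrite <- plus_n_Sm; easy).
      replace (Cminus _ _) with
        (Cminus (Cminus X (Cmult Y (c (p + m')%nat)))
           (Cmult Y (Cminus (c (S (p + m'))) (c (p + m')%nat)))) by ring.
      eapply Rle_trans; [apply Cmod_triangle|]. rewrite Cmod_opp, Cmod_mult.
      assert (HY : Cmod Y <= V) by (apply HA; lia).
      assert (Hd := HT m' ltac:(lia)).
      assert (Cmod Y * Cmod (Cminus (c (S (p + m'))) (c (p + m')%nat))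
              <= V * (T (S (p + m')) - T (p + m')%nat))
        by (apply Rmult_le_compat; auto using Cmod_ge_0).
      lra. }
  specialize (W m (le_n m)).
  assert (HS := HA (S m) (le_n _)).
  set (X := csum (fun n => Cmult (a n) (c n)) p (S m)) in *.
  set (Y := csum a p (S m)) in *.
  replace X with (Cplus (Cminus X (Cmult Y (c (p + m)%nat))) (Cmult Y (c (p + m)%nat))) by ring.
  eapply Rle_trans; [apply Cmod_triangle|]. rewrite Cmod_mult.
  assert (Cmod Y * Cmod (c (p + m)%nat) <= V * Cmod (c (p + m)%nat))
    by (apply Rmult_le_compat_r; [apply Cmod_ge_0|exact HS]).
  lra.
Qed.

Lemma half_le_sin (x : R) : 0 <= x <= 1 -> x / 2 <= sin x.
Proof.
  intros Hx.
  assert (H := increment_le (fun x => x / 2) sin (fun _ => 1 / 2) cos 0 x (proj1 Hx)).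
  cbv beta in H. rewrite sin_0 in H.
  apply Rle_trans with (Rabs (x / 2 - 0 / 2)).
  { eapply Rle_trans; [|apply Rle_abs]. lra. }
  replace (sin x) with (sin x - 0) by ring. apply H.
  - intros; auto_derive; [easy|field].
  - intros; auto_derive; [easy|ring].
  - intros y Hy. rewrite Rabs_pos_eq by lra.
    rewrite <- cos_PI3. assert (P := PI2_3_2).
    apply cos_decr_1; try lra.
Qed.

Definition diff1 (f : nat -> R) (n : nat) : R := f (S n) - f n.

Definition cot (x : R) : R := cos x / sin x.

(** This is [1 / (1 - exp (i d)) = (1 + i cot (d/2)) / 2], with [d/2] reduced modulo [PI]. It
    rewrites each term as a telescoping difference times a weight whose real part is constant and
    whose imaginary part is monotone in [x]. *)
Lemma kusmin_landau_identity (F x d : R) (k : nat) :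
  sin x <> 0 -> d = 2 * x + 2 * INR k * PI ->
  cis F = Cmult (Cminus (cis F) (cis (F + d))) (1 / 2, cot x / 2).
Proof.
  intros Hx Hd. unfold cis, cot. subst d.
  rewrite <- Rplus_assoc, cos_period, sin_period.
  replace (F + 2 * x) with (F + x + x) by ring.
  assert (HF : F = F + x - x) by ring.
  set (y := F + x) in *. rewrite HF. clear HF.
  rewrite cos_minus, sin_minus, cos_plus, sin_plus.
  unfold Cmult, Cminus, Cplus, Copp; cbn [fst snd]. f_equal; field; exact Hx.
Qed.

Lemma cot_variation (x y : R) : 0 < x -> x <= y -> y < PI -> 
  0 <= cot x - cot y.
Proof.
  intros Hx Hxy Hy. unfold cot.
  assert (S1 : 0 < sin x) by (apply sin_gt_0; lra).
  assert (S2 : 0 < sin y) by (apply sin_gt_0; lra).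
  assert (S3 : 0 <= sin (y - x)) by (apply sin_ge_0; lra).
  rewrite sin_minus in S3.
  replace (cos x / sin x - cos y / sin y)
    with ((sin y * cos x - cos y * sin x) / (sin x * sin y)) by (field; lra).
  apply Rdiv_le_0_compat; [exact S3|now apply Rmult_lt_0_compat].
Qed.

Lemma sin_lower (d x : R) : 0 < d <= 1 -> d / 2 <= x <= PI - d / 2 -> d / 4 <= sin x.
Proof.
  intros Hd Hx. assert (P := PI2_3_2).
  apply Rle_trans with (sin (d / 2)).
  { generalize (half_le_sin (d / 2)). lra. }
  destruct (Rle_lt_dec x (PI / 2)) as [H|H].
  - apply sin_incr_1; lra.
  - rewrite <- (sin_PI_x x). apply sin_incr_1; lra.
Qed.

(** Partial sums of the telescoping differences are at most 2, and the variation of the monotone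
    cotangents is the difference of their end values. With [|cot| <= 4/d] the total is
    [2 * (1/2 + 2/d + 4/d) = 1 + 12/d], at most [13/d] since [d <= 1]. *)
Lemma kusmin_landau (f : nat -> R) (p m k : nat) (d : R) :
  0 < d <= 1 ->
  (forall j, (j < m)%nat ->
     2 * INR k * PI + d <= diff1 f (p + j) <= 2 * (INR k + 1) * PI - d) ->
  (forall j, (S j < m)%nat -> diff1 f (p + j) <= diff1 f (S (p + j))) ->
  Cmod (csum (fun n => cis (f n)) p m) <= 13 / d.
Proof.
  intros Hd Hrange Hmono.
  assert (Hd0 : 0 <= 13 / d) by (apply Rdiv_le_0_compat; lra).
  destruct m as [|m]; [simpl; rewrite Cmod_0; exact Hd0|].
  set (x := fun n => (diff1 f n - 2 * INR k * PI) / 2).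
  assert (Hx : forall j, (j < S m)%nat -> d / 2 <= x (p + j)%nat <= PI - d / 2)
    by (intros j Hj; specialize (Hrange j Hj); unfold x; lra).
  assert (Hsin : forall j, (j < S m)%nat -> d / 4 <= sin (x (p + j)%nat))
    by (intros j Hj; apply sin_lower; auto).
  set (a := fun n => Cminus (cis (f n)) (cis (f (S n)))).
  set (c := fun n => (1 / 2, cot (x n) / 2) : C).
  rewrite (csum_ext _ (fun n => Cmult (a n) (c n))).
  2:{ intros j Hj. unfold a, c.
      assert (Hs := Hsin j Hj).
      rewrite (kusmin_landau_identity (f (p + j)%nat) (x (p + j)%nat) (diff1 f (p + j)) k) at 1.
      - unfold diff1. replace (f (p + j)%nat + (f (S (p + j)) - f (p + j)%nat))
          with (f (S (p + j))) by ring. easy.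
      - lra.
      - unfold x. field. }
  assert (Hc : forall j, (j < S m)%nat -> Rabs (cot (x (p + j)%nat)) <= 4 / d).
  { intros j Hj. assert (Hs := Hsin j Hj). unfold cot, Rdiv at 1.
    rewrite Rabs_mult, Rabs_inv, (Rabs_pos_eq (sin _)) by lra.
    replace (4 / d) with (1 * / (d / 4)) by (field; lra).
    apply Rmult_le_compat; [apply Rabs_pos|left; apply Rinv_0_lt_compat; lra| |].
    - apply Rabs_le, COS_bound.
    - apply Rinv_le_contravar; lra. }
  assert (HA : forall j, csum a p j = Cminus (cis (f p)) (cis (f (p + j)%nat))).
  { induction j as [|j IH]; simpl.
    - rewrite Nat.add_0_r. ring.
    - rewrite IH. unfold a. rewrite <- plus_n_Sm. ring. }
  eapply Rle_trans.
  { apply (abel_summation a c (fun n => - (cot (x n) / 2)) 2 p m).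
    - intros j _. rewrite HA. eapply Rle_trans; [apply Cmod_triangle|].
      rewrite Cmod_opp, !Cmod_cis. lra.
    - intros j Hj. unfold c.
      replace (Cminus (1 / 2, cot (x (S (p + j))) / 2) (1 / 2, cot (x (p + j)%nat) / 2))
        with (Cmult (RtoC ((cot (x (p + j)%nat) - cot (x (S (p + j)))) / 2)) (0, -1)).
      2:{ unfold Cmult, Cminus, Cplus, Copp, RtoC; cbn [fst snd]. f_equal; field. }
      rewrite Cmod_mult, Cmod_R.
      assert (H1 : Cmod (0, -1) = 1).
      { unfold Cmod; cbn [fst snd]. replace (0 ^ 2 + (-1) ^ 2) with 1 by ring. apply sqrt_1. }
      rewrite H1.
      assert (H2 := Hx j ltac:(lia)). assert (H3 := Hx (S j) ltac:(lia)).
      rewrite <- plus_n_Sm in H3. assert (P := PI2_3_2).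
      assert (H4 := Hmono j ltac:(lia)).
      assert (H5 : 0 <= cot (x (p + j)%nat) - cot (x (S (p + j))))
        by (apply cot_variation; unfold x in *; lra).
      rewrite Rabs_pos_eq by lra. lra. }
  assert (H0 := Hc 0%nat ltac:(lia)). rewrite Nat.add_0_r in H0.
  assert (H1 := Hc m ltac:(lia)).
  assert (Hcm : Cmod (c (p + m)%nat) <= 1 / 2 + 4 / d / 2).
  { unfold c. eapply Rle_trans; [apply Cmod_le_sum|]; cbn [fst snd].
    rewrite (Rabs_pos_eq (1 / 2)) by lra.
    unfold Rdiv at 2. rewrite Rabs_mult, (Rabs_pos_eq (/ 2)) by lra. lra. }
  apply Rabs_le_between in H0. apply Rabs_le_between in H1.
  replace (13 / d) with (3 * (4 / d) + 1 / d) by (field; lra).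
  assert (1 <= 1 / d).
  { apply Rmult_le_reg_r with d; [lra|]. replace (1 / d * d) with 1 by (field; lra). lra. }
  lra.
Qed.

Lemma threshold (D : nat -> R) (p m : nat) (t : R) :
  (forall j, (S j < m)%nat -> D (p + j)%nat <= D (S (p + j))) ->
  exists m1, (m1 <= m)%nat /\ (forall j, (j < m1)%nat -> D (p + j)%nat < t) /\
    (forall j, (m1 <= j < m)%nat -> t <= D (p + j)%nat).
Proof.
  induction m as [|m IH]; intros Hm.
  - exists 0%nat. repeat split; intros; lia.
  - destruct IH as [m1 [H1 [H2 H3]]]; [intros; apply Hm; lia|].
    destruct (Nat.eq_dec m1 m) as [E|E].
    + subst m1. destruct (Rlt_le_dec (D (p + m)%nat) t) as [L|L].
      * exists (S m). split; [lia|]. split; [|intros; lia].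
        intros j Hj. destruct (Nat.eq_dec j m); [now subst|apply H2; lia].
      * exists m. split; [lia|]. split; [exact H2|].
        intros j Hj. now replace j with m by lia.
    + exists m1. split; [lia|]. split; [exact H2|].
      intros j Hj. destruct (Nat.eq_dec j m) as [->|N]; [|apply H3; lia].
      destruct m as [|m']; [lia|].
      eapply Rle_trans; [apply (H3 m'); lia|].
      rewrite <- plus_n_Sm. apply Hm. lia.
Qed.

Lemma gap_count (D : nat -> R) (p m : nat) (lam u L : R) :
  0 < lam -> 0 <= L ->
  (forall j, (S j < m)%nat -> lam <= D (S (p + j)) - D (p + j)%nat) ->
  (forall j, (j < m)%nat -> u <= D (p + j)%nat <= u + L) ->
  INR m <= L / lam + 1.
Proof.
  intros Hl HL Hg Hr.
  destruct m as [|m].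
  - simpl. assert (0 <= L / lam) by (apply Rdiv_le_0_compat; lra). lra.
  - assert (W : forall j, (j <= m)%nat -> INR j * lam <= D (p + j)%nat - D p).
    { induction j as [|j IH]; intros Hj.
      - rewrite Nat.add_0_r. simpl. lra.
      - rewrite S_INR, <- plus_n_Sm. specialize (IH ltac:(lia)).
        specialize (Hg j ltac:(lia)). lra. }
    specialize (W m (le_n m)).
    assert (R0 := Hr 0%nat ltac:(lia)). rewrite Nat.add_0_r in R0.
    assert (R1 := Hr m ltac:(lia)).
    rewrite S_INR. apply Rplus_le_compat_r.
    apply Rmult_le_reg_r with lam; [lra|]. replace (L / lam * lam) with L by (field; lra). lra.
Qed.

(** Kusmin-Landau fails only where the first difference is within [d] of a multiple of [2 * PI]. The
    growth [lam] leaves at most [d / lam + 1] indices at each end of the period, and these are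
    summed trivially. *)
Lemma one_period (f : nat -> R) (p m k : nat) (d lam : R) :
  0 < d <= 1 -> 0 < lam ->
  (forall j, (S j < m)%nat -> lam <= diff1 f (S (p + j)) - diff1 f (p + j)) ->
  (forall j, (j < m)%nat ->
     2 * INR k * PI <= diff1 f (p + j) <= 2 * (INR k + 1) * PI) ->
  Cmod (csum (fun n => cis (f n)) p m) <= 2 * (d / lam + 1) + 13 / d.
Proof.
  intros Hd Hl Hg Hr.
  assert (Hmono : forall j, (S j < m)%nat -> diff1 f (p + j) <= diff1 f (S (p + j)))
    by (intros j Hj; specialize (Hg j Hj); lra).
  destruct (threshold (diff1 f) p m (2 * INR k * PI + d) Hmono) as [m1 [L1 [A1 A2]]].
  destruct (threshold (diff1 f) p m (2 * (INR k + 1) * PI - d) Hmono) as [m2 [L2 [B1 B2]]].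
  assert (P := PI2_3_2).
  assert (L12 : (m1 <= m2)%nat).
  { apply Nat.nlt_ge. intros H.
    specialize (A1 m2 H). specialize (B2 m2 ltac:(lia)). lra. }
  replace m with (m1 + (m2 - m1) + (m - m2))%nat by lia.
  rewrite !csum_app.
  replace (p + (m1 + (m2 - m1)))%nat with (p + m2)%nat by lia.
  assert (E1 : Cmod (csum (fun n => cis (f n)) p m1) <= d / lam + 1).
  { eapply Rle_trans; [apply csum_trivial_bound; intros; rewrite Cmod_cis; lra|].
    apply (gap_count (diff1 f) p m1 lam (2 * INR k * PI) d); try lra.
    - intros; apply Hg; lia.
    - intros j Hj. specialize (A1 j Hj). specialize (Hr j ltac:(lia)). lra. }
  assert (E3 : Cmod (csum (fun n => cis (f n)) (p + m2) (m - m2)) <= d / lam + 1).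
  { eapply Rle_trans; [apply csum_trivial_bound; intros; rewrite Cmod_cis; lra|].
    apply (gap_count (diff1 f) (p + m2) (m - m2) lam (2 * (INR k + 1) * PI - d) d); try lra.
    - intros j Hj. rewrite <- Nat.add_assoc. apply Hg; lia.
    - intros j Hj. rewrite <- Nat.add_assoc.
      specialize (B2 (m2 + j)%nat ltac:(lia)). specialize (Hr (m2 + j)%nat ltac:(lia)). lra. }
  assert (E2 : Cmod (csum (fun n => cis (f n)) (p + m1) (m2 - m1)) <= 13 / d).
  { apply kusmin_landau with k; [exact Hd| |].
    - intros j Hj. rewrite <- Nat.add_assoc.
      specialize (A2 (m1 + j)%nat ltac:(lia)). specialize (B1 (m1 + j)%nat ltac:(lia)). lra.
    - intros j Hj. rewrite <- Nat.add_assoc. apply Hmono; lia. }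
  eapply Rle_trans; [apply Cmod_triangle|].
  eapply Rle_trans; [apply Rplus_le_compat_r, Cmod_triangle|]. lra.
Qed.

Lemma many_periods (f : nat -> R) (d lam : R) (N p m k : nat) :
  0 < d <= 1 -> 0 < lam ->
  (forall j, (S j < m)%nat -> lam <= diff1 f (S (p + j)) - diff1 f (p + j)) ->
  (forall j, (j < m)%nat ->
     2 * INR k * PI <= diff1 f (p + j) <= 2 * (INR k + INR N) * PI) ->
  Cmod (csum (fun n => cis (f n)) p m) <= (INR N + 1) * (2 * (d / lam + 1) + 13 / d).
Proof.
  intros Hd Hl. revert p m k.
  assert (Hpos : 0 <= 2 * (d / lam + 1) + 13 / d).
  { assert (0 <= d / lam) by (apply Rdiv_le_0_compat; lra).
    assert (0 <= 13 / d) by (apply Rdiv_le_0_compat; lra). lra. }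
  assert (P := PI2_3_2).
  induction N as [|N IH]; intros p m k Hg Hr.
  - eapply Rle_trans; [apply (one_period f p m k d lam); auto|].
    + intros j Hj. specialize (Hr j Hj). simpl in Hr. lra.
    + simpl. lra.
  - assert (Hmono : forall j, (S j < m)%nat -> diff1 f (p + j) <= diff1 f (S (p + j)))
      by (intros j Hj; specialize (Hg j Hj); lra).
    destruct (threshold (diff1 f) p m (2 * (INR k + 1) * PI) Hmono) as [m1 [L1 [A1 A2]]].
    replace m with (m1 + (m - m1))%nat by lia. rewrite csum_app.
    eapply Rle_trans; [apply Cmod_triangle|].
    assert (E1 : Cmod (csum (fun n => cis (f n)) p m1) <= 2 * (d / lam + 1) + 13 / d).
    { apply one_period with k; auto.
      - intros; apply Hg; lia.
      - intros j Hj. specialize (A1 j Hj). specialize (Hr j ltac:(lia)). lra. }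
    assert (E2 := IH (p + m1)%nat (m - m1)%nat (S k)).
    rewrite S_INR.
    assert (E2' : Cmod (csum (fun n => cis (f n)) (p + m1) (m - m1))
                    <= (INR N + 1) * (2 * (d / lam + 1) + 13 / d)).
    { apply E2.
      - intros j Hj. rewrite <- Nat.add_assoc. apply Hg; lia.
      - intros j Hj. rewrite <- Nat.add_assoc, S_INR.
        specialize (A2 (m1 + j)%nat ltac:(lia)). specialize (Hr (m1 + j)%nat ltac:(lia)).
        rewrite S_INR in Hr. lra. }
    lra.
Qed.

(** The choice [d = sqrt lam] balances [d / lam] against [1 / d], and [lam <= 1] absorbs the
    additive constant: [2 * (/ sqrt lam + 1) + 13 / sqrt lam <= 17 / sqrt lam]. *)
Lemma van_der_corput (f : nat -> R) (p m : nat) (lam L : R) :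
  0 < lam <= 1 -> 0 <= L ->
  (forall j, (S j < m)%nat -> lam <= diff1 f (S (p + j)) - diff1 f (p + j)) ->
  (forall j, (j < m)%nat ->
     0 <= diff1 f p /\ diff1 f p <= diff1 f (p + j) <= diff1 f p + L) ->
  Cmod (csum (fun n => cis (f n)) p m) <= (L + 3) * (17 / sqrt lam).
Proof.
  intros Hl HL Hg Hr.
  assert (Hs : 0 < sqrt lam) by (apply sqrt_lt_R0; lra).
  assert (Hs1 : sqrt lam <= 1) by (rewrite <- sqrt_1; apply sqrt_le_1; lra).
  assert (Hss := sqrt_sqrt lam ltac:(lra)).
  assert (H16 : 0 <= 17 / sqrt lam) by (apply Rdiv_le_0_compat; lra).
  destruct m as [|m]; [simpl; rewrite Cmod_0; apply Rmult_le_pos; lra|].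
  assert (P := PI2_3_2).
  assert (H0 := Hr 0%nat ltac:(lia)).
  destruct (nfloor_ex (diff1 f p / (2 * PI))) as [k [K1 K2]].
  { apply Rdiv_le_0_compat; lra. }
  destruct (nfloor_ex L HL) as [N [N1 N2]].
  assert (K1' : 2 * INR k * PI <= diff1 f p).
  { apply Rmult_le_reg_r with (/ (2 * PI)); [apply Rinv_0_lt_compat; lra|].
    replace (2 * INR k * PI * / (2 * PI)) with (INR k) by (field; lra). exact K1. }
  assert (K2' : diff1 f p <= 2 * (INR k + 1) * PI).
  { apply Rmult_le_reg_r with (/ (2 * PI)); [apply Rinv_0_lt_compat; lra|].
    replace (2 * (INR k + 1) * PI * / (2 * PI)) with (INR k + 1) by (field; lra).
    unfold Rdiv in K2. lra. }
  (* [k] is the period containing the first value. One period completes it and [N + 1] more cover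
     the remaining range, as [L <= N + 1 <= 2 * (N + 1) * PI]. *)
  eapply Rle_trans; [apply (many_periods f (sqrt lam) lam (N + 2) p (S m) k); auto; try lra|].
  - intros j Hj. specialize (Hr j Hj). rewrite plus_INR. simpl (INR 2).
    assert (L <= 2 * (INR N + 1) * PI) by nra. lra.
  - rewrite plus_INR. simpl (INR 2).
    assert (E : sqrt lam / lam = / sqrt lam) by (rewrite <- Hss at 2; field; lra).
    rewrite E.
    assert (1 <= / sqrt lam) by (rewrite <- Rinv_1; apply Rinv_le_contravar; lra).
    assert (2 * (/ sqrt lam + 1) + 13 / sqrt lam <= 17 / sqrt lam) by (unfold Rdiv; lra).
    apply Rmult_le_compat; try lra.
Qed.

(** * Sums over a window *)

Lemma MVT_bounds (f df : R -> R) (a b lo hi : R) :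
  a <= b ->
  (forall x, a <= x <= b -> is_derive f x (df x)) ->
  (forall x, a <= x <= b -> lo <= df x <= hi) ->
  lo * (b - a) <= f b - f a <= hi * (b - a).
Proof.
  intros Hab Hd Hb.
  destruct (MVT_gen f a b df) as [c [Hc Heq]].
  - intros x Hx. rewrite Rmin_left, Rmax_right in Hx by lra. apply Hd; lra.
  - intros x Hx. rewrite Rmin_left, Rmax_right in Hx by lra.
    apply continuity_pt_filterlim, (ex_derive_continuous f). exists (df x). apply Hd; lra.
  - rewrite Rmin_left, Rmax_right in Hc by lra. rewrite Heq.
    specialize (Hb c Hc). split; apply Rmult_le_compat_r; lra.
Qed.

Lemma second_difference (g g1 g2 : R -> R) (u lo hi : R) :
  (forall x, u <= x <= u + 2 -> is_derive g x (g1 x)) ->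
  (forall x, u <= x <= u + 2 -> is_derive g1 x (g2 x)) ->
  (forall x, u <= x <= u + 2 -> lo <= g2 x <= hi) ->
  lo <= (g (u + 2) - g (u + 1)) - (g (u + 1) - g u) <= hi.
Proof.
  intros D1 D2 Hb.
  assert (H := MVT_bounds (fun x => g (x + 1) - g x) (fun x => g1 (x + 1) - g1 x)
    u (u + 1) lo hi ltac:(lra)).
  cbv beta in H. replace (u + 1 + 1) with (u + 2) in H by ring.
  assert (lo * (u + 1 - u) <= g (u + 2) - g (u + 1) - (g (u + 1) - g u) <= hi * (u + 1 - u)).
  { apply H; clear H.
    - intros x Hx.
      apply (is_derive_minus (fun x => g (x + 1)) g); [|apply D1; lra].
      replace (g1 (x + 1)) with (scal 1 (g1 (x + 1)))
        by (unfold scal; simpl; unfold mult; simpl; ring).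
      apply (is_derive_comp g (fun x => x + 1)); [apply D1; lra|].
      auto_derive; [easy|ring].
    - intros x Hx.
      assert (M := MVT_bounds g1 g2 x (x + 1) lo hi ltac:(lra)).
      assert (lo * (x + 1 - x) <= g1 (x + 1) - g1 x <= hi * (x + 1 - x)).
      { apply M; intros y Hy; [apply D2; lra|apply Hb; lra]. }
      lra. }
  lra.
Qed.

Lemma Rceil_bounds (x : R) : x <= IZR (Rceil x) < x + 1.
Proof.
  unfold Rceil. rewrite minus_IZR. destruct (archimed (- x)) as [H1 H2]. lra.
Qed.

Lemma sqr_PI_bounds : 9 <= PI ^ 2 <= 16.
Proof. assert (P1 := PI2_3_2). assert (P2 := PI_4). nra. Qed.

Lemma xl_bounds (F : R) (l : nat) : 0 < F ->
  PI ^ 2 * (INR l - 1 / 2) ^ 2 - F / 2 <= F * xl F l <= PI ^ 2 * (INR l - 1 / 2) ^ 2 + F / 2.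
Proof.
  intros HF. unfold xl. set (y := PI ^ 2 / F * (INR l - 1 / 2) ^ 2).
  assert (Hy : F * y = PI ^ 2 * (INR l - 1 / 2) ^ 2) by (unfold y; field; lra).
  rewrite <- Hy. assert (H := Rceil_bounds y). split; nra.
Qed.

(** From [9 <= PI^2 <= 16] follows [2 l <= sqrt (F x + E) <= 6 l] on the window, whence 24 and 2;
    the length constant 33 is [2 * 16] plus 1 for the rounding, as [F <= l]. The range reaches one
    unit past the window because second differences at its last index do. *)
Lemma window_asymptotics (F E : R) (g : R -> R) :
  0 < F -> is_phase_of_zeta F E g ->
  exists (g1 g2 : R -> R) (L0 : R), 1 <= L0 /\ forall l : nat, L0 <= INR l ->
    F <= INR l /\ xl F (S l) - xl F l <= 33 * INR l / F /\
    forall x, xl F l <= x <= xl F (S l) + 1 ->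
      INR l ^ 2 / F <= x /\ is_derive g x (g1 x) /\ is_derive g1 x (g2 x) /\
      INR l <= g1 x /\ F / (24 * INR l) <= g2 x <= F / (2 * INR l).
Proof.
  intros HF Hph.
  destruct (phase_asymptotics F E g HF Hph) as [X0 [g1 [g2 HX]]].
  assert (PP := sqr_PI_bounds).
  exists g1, g2, (4 + 5 * F + 2 * Rabs E + F * (Rabs X0 + 1)).
  assert (A1 := Rabs_pos E). assert (A2 := Rabs_pos X0).
  assert (A3 : 0 <= F * (Rabs X0 + 1)) by (apply Rmult_le_pos; lra).
  split; [lra|]. intros l Hl.
  set (n := INR l) in *.
  assert (B1 := xl_bounds F l HF). assert (B2 := xl_bounds F (S l) HF).
  rewrite S_INR in B2. fold n in B1, B2.
  replace (n + 1 - 1 / 2) with (n + 1 / 2) in B2 by field.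
  assert (E1 := Rle_abs E). assert (E2 := Rle_abs (- E)). rewrite Rabs_Ropp in E2.
  split; [lra|]. split.
  - apply Rmult_le_reg_l with F; [lra|].
    replace (F * (33 * n / F)) with (33 * n) by (field; lra).
    assert (PI ^ 2 * (2 * n) <= 16 * (2 * n)) by (apply Rmult_le_compat_r; lra).
    lra.
  - intros x Hx.
    assert (C1 : F * xl F l <= F * x) by (apply Rmult_le_compat_l; lra).
    assert (C2 : F * x <= F * (xl F (S l) + 1)) by (apply Rmult_le_compat_l; lra).
    assert (Hn : 4 * n <= n ^ 2)
      by (replace (n ^ 2) with (n * n) by ring; apply Rmult_le_compat_r; lra).
    assert (Q1 : (n - 1 / 2) ^ 2 = n ^ 2 - n + 1 / 4) by field.
    assert (Q2 : (n + 1 / 2) ^ 2 = n ^ 2 + n + 1 / 4) by field.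
    assert (Lo : 4 * n ^ 2 <= F * x + E).
    { assert (9 * (n - 1 / 2) ^ 2 <= PI ^ 2 * (n - 1 / 2) ^ 2)
        by (apply Rmult_le_compat_r; [apply pow2_ge_0|lra]).
      lra. }
    assert (Lo' : n ^ 2 <= F * x).
    { assert (9 * (n - 1 / 2) ^ 2 <= PI ^ 2 * (n - 1 / 2) ^ 2)
        by (apply Rmult_le_compat_r; [apply pow2_ge_0|lra]).
      lra. }
    assert (Hi : F * x + E <= 36 * n ^ 2).
    { assert (PI ^ 2 * (n + 1 / 2) ^ 2 <= 16 * (n + 1 / 2) ^ 2)
        by (apply Rmult_le_compat_r; [apply pow2_ge_0|lra]).
      lra. }
    assert (Hxn : n ^ 2 / F <= x).
    { apply Rmult_le_reg_l with F; [lra|].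
      replace (F * (n ^ 2 / F)) with (n ^ 2) by (field; lra). exact Lo'. }
    split; [exact Hxn|].
    assert (HX0 : X0 < x).
    { assert (X0 <= Rabs X0) by apply Rle_abs.
      apply Rmult_lt_reg_l with F; [lra|].
      apply Rlt_le_trans with (n ^ 2); [|exact Lo'].
      assert (F * X0 <= F * Rabs X0) by (apply Rmult_le_compat_l; lra). lra. }
    destruct (HX x HX0) as [Hpos [D1 [D2 [G1 G2]]]].
    assert (S1 : 2 * n <= sqrt (F * x + E)).
    { rewrite <- (sqrt_pow2 (2 * n)) by lra. apply sqrt_le_1_alt. lra. }
    assert (S2 : sqrt (F * x + E) <= 6 * n).
    { rewrite <- (sqrt_pow2 (6 * n)) by lra. apply sqrt_le_1_alt. lra. }
    repeat (split; [assumption||lra|]). split.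
    + eapply Rle_trans; [|apply G2]. apply Rmult_le_compat_l; [lra|].
      apply Rinv_le_contravar; lra.
    + eapply Rle_trans; [apply G2|]. apply Rmult_le_compat_l; [lra|].
      apply Rinv_le_contravar; lra.
Qed.

(** The window has at most about [33 l / F] integers, and the first difference of [mu * gamma] grows
    by at most [mu F / (2 l)] per step. Its total growth is thus at most [33/2 * mu <= 17 * mu]: the
    number of periods met does not grow with [l]. *)
Lemma phase_sum_bound (g g1 g2 : R -> R) (F l mu lo hi : R) (p m : nat) :
  0 < F <= l -> 0 < mu -> mu * F <= 24 * l -> hi - lo <= 33 * l / F ->
  (forall x, lo <= x <= hi + 1 ->
     is_derive g x (g1 x) /\ is_derive g1 x (g2 x) /\
     l <= g1 x /\ F / (24 * l) <= g2 x <= F / (2 * l)) ->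
  lo <= INR p -> INR (p + m) <= hi ->
  forall j, (j <= S m)%nat ->
    Cmod (csum (fun n => cis (mu * g (INR n))) p j)
      <= (17 * mu + 3) * (17 / sqrt (mu * F / (24 * l))).
Proof.
  intros HF Hmu Hsmall Hlen HD Hlo Hhi j Hj.
  set (f := fun n => mu * g (INR n)).
  assert (Hpm : forall i, INR (p + i) = INR p + INR i) by (intros; apply plus_INR).
  assert (Hp : forall i, (i <= m)%nat -> lo <= INR (p + i) <= hi).
  { intros i Hi. assert (INR i <= INR m) by now apply le_INR.
    assert (0 <= INR i) by apply pos_INR. rewrite Hpm in *. lra. }
  assert (H2 : forall i, (S i < j)%nat ->
    mu * F / (24 * l) <= diff1 f (S (p + i)) - diff1 f (p + i) <= mu * F / (2 * l)).
  { intros i Hi. unfold diff1, f. rewrite !S_INR.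
    assert (P1 := Hp i ltac:(lia)). assert (P2 := Hp (S i) ltac:(lia)).
    rewrite Hpm, S_INR, <- Rplus_assoc in P2. rewrite Hpm in P1. rewrite !Hpm.
    set (u := INR p + INR i) in *.
    assert (S := second_difference g g1 g2 u (F / (24 * l)) (F / (2 * l))).
    replace (u + 1 + 1) with (u + 2) by ring.
    assert (F / (24 * l) <= g (u + 2) - g (u + 1) - (g (u + 1) - g u) <= F / (2 * l))
      by (apply S; intros x Hx; apply HD; lra).
    replace (mu * F / (24 * l)) with (mu * (F / (24 * l))) by (field; lra).
    replace (mu * F / (2 * l)) with (mu * (F / (2 * l))) by (field; lra).
    replace (mu * g (u + 2) - mu * g (u + 1) - (mu * g (u + 1) - mu * g u))
      with (mu * (g (u + 2) - g (u + 1) - (g (u + 1) - g u))) by ring.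
    split; apply Rmult_le_compat_l; lra. }
  assert (Hlam : 0 < mu * F / (24 * l)).
  { apply Rdiv_lt_0_compat; [apply Rmult_lt_0_compat; lra|lra]. }
  apply van_der_corput.
  - split; [exact Hlam|]. apply Rmult_le_reg_r with (24 * l); [lra|].
    replace (mu * F / (24 * l) * (24 * l)) with (mu * F) by (field; lra). lra.
  - lra.
  - intros i Hi. apply H2, Hi.
  - intros i Hi.
    assert (D0 : 0 <= diff1 f p).
    { unfold diff1, f. rewrite S_INR.
      assert (P1 := Hp 0%nat ltac:(lia)). rewrite Nat.add_0_r in P1.
      replace (mu * g (INR p + 1) - mu * g (INR p))
        with (mu * (g (INR p + 1) - g (INR p))) by ring.
      apply Rmult_le_pos; [lra|].
      destruct (MVT_gen g (INR p) (INR p + 1) g1) as [c [Hc Heq]].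
      - intros x Hx. rewrite Rmin_left, Rmax_right in Hx by lra. apply HD; lra.
      - intros x Hx. rewrite Rmin_left, Rmax_right in Hx by lra.
        apply continuity_pt_filterlim, (ex_derive_continuous g).
        exists (g1 x). apply HD; lra.
      - rewrite Rmin_left, Rmax_right in Hc by lra. rewrite Heq.
        destruct (HD c ltac:(lra)) as [_ [_ [G _]]]. apply Rmult_le_pos; lra. }
    assert (W : forall i, (i < j)%nat ->
      diff1 f p <= diff1 f (p + i) <= diff1 f p + INR i * (mu * F / (2 * l))).
    { induction i0 as [|i0 IH]; intros Hi0.
      - rewrite Nat.add_0_r. simpl. lra.
      - rewrite <- plus_n_Sm, S_INR. specialize (IH ltac:(lia)).
        specialize (H2 i0 Hi0). lra. }
    split; [exact D0|]. specialize (W i Hi).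
    assert (Hi' := Hp i ltac:(lia)). rewrite Hpm in Hi'.
    assert (INR i * (mu * F / (2 * l)) <= 33 * l / F * (mu * F / (2 * l))).
    { apply Rmult_le_compat_r; [|lra].
      apply Rlt_le, Rdiv_lt_0_compat; [apply Rmult_lt_0_compat; lra|lra]. }
    replace (33 * l / F * (mu * F / (2 * l))) with (33 / 2 * mu) in H by (field; lra).
    fold f. lra.
Qed.

(** * Window sums as contiguous blocks, and their weights *)

(** The last clause is the induction invariant that excludes gaps: a nonempty block either still
    ends at the current index or has already been closed by [b]. *)
Lemma window_sum_block (u : nat -> C) (a b : R) (N : nat) :
  exists p m,
    sum_n (fun n : nat => if Rlt_dec a (INR n) then
             if Rle_dec (INR n) b then u n else zero else zero) N = csum u p m /\
    (forall j, (j < m)%nat -> a < INR (p + j) <= b) /\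
    ((0 < m)%nat -> (p + m)%nat = S N \/ b < INR (S N)).
Proof.
  induction N as [|N [p [m [Heq [Hin Hend]]]]].
  - rewrite sum_O.
    destruct (Rlt_dec a (INR 0)) as [H1|H1]; [destruct (Rle_dec (INR 0) b) as [H2|H2]|].
    + exists 0%nat, 1%nat. split; [simpl; change zero with (RtoC 0); ring|].
      split; [|left; lia]. intros j Hj. replace (0 + j)%nat with 0%nat by lia. lra.
    + exists 0%nat, 0%nat. split; [easy|]. split; intros; lia.
    + exists 0%nat, 0%nat. split; [easy|]. split; intros; lia.
  - rewrite sum_Sn, Heq.
    destruct (Rlt_dec a (INR (S N))) as [H1|H1];
      [destruct (Rle_dec (INR (S N)) b) as [H2|H2]|].
    + destruct m as [|m].
      * exists (S N), 1%nat. split.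
        { simpl. rewrite Nat.add_0_r. easy. }
        split; [|left; lia].
        intros j Hj. replace (S N + j)%nat with (S N) by lia. lra.
      * destruct (Hend ltac:(lia)) as [E|E]; [|lra].
        exists p, (S (S m)). split.
        { simpl. replace (p + S m)%nat with (S N) by lia. easy. }
        split; [|left; lia]. intros j Hj. destruct (Nat.eq_dec j (S m)) as [->|Hne].
        { rewrite E. lra. }
        apply Hin. lia.
    + exists p, m. split; [apply plus_zero_r|]. split; [exact Hin|].
      intros _. right. rewrite S_INR. lra.
    + exists p, m. split; [apply plus_zero_r|]. split; [exact Hin|].
      intros Hm. exfalso. specialize (Hin 0%nat Hm).
      destruct (Hend Hm) as [E|E].
      * assert (INR (p + 0) <= INR (S N)) by (apply le_INR; lia). lra.
      * lra.
Qed.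

Lemma cis_lipschitz (s t : R) : Cmod (Cminus (cis s) (cis t)) <= 2 * Rabs (s - t).
Proof.
  assert (W : forall s t, t <= s ->
    Rabs (cos s - cos t) <= s - t /\ Rabs (sin s - sin t) <= s - t).
  { clear. intros s t H. split.
    - apply (increment_le cos (fun x => x) (fun x => - sin x) (fun _ => 1)); auto.
      + intros; auto_derive; [easy|ring].
      + intros; auto_derive; [easy|ring].
      + intros. rewrite Rabs_Ropp. apply Rabs_le, SIN_bound.
    - apply (increment_le sin (fun x => x) cos (fun _ => 1)); auto.
      + intros; auto_derive; [easy|ring].
      + intros; auto_derive; [easy|ring].
      + intros. apply Rabs_le, COS_bound. }
  eapply Rle_trans; [apply Cmod_le_sum|]. unfold cis; cbn [fst snd].
  change (fst (Cminus (cos s, sin s) (cos t, sin t))) with (cos s - cos t).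
  change (snd (Cminus (cos s, sin s) (cos t, sin t))) with (sin s - sin t).
  destruct (Rle_lt_dec t s) as [H|H].
  - destruct (W s t H). rewrite (Rabs_pos_eq (s - t)); lra.
  - destruct (W t s ltac:(lra)). rewrite (Rabs_minus_sym (cos s)), (Rabs_minus_sym (sin s)),
      (Rabs_minus_sym s), (Rabs_pos_eq (t - s)); lra.
Qed.

Lemma Rpower_neg_le (x y c : R) : 0 < x -> x <= y -> 0 <= c -> Rpower y (- c) <= Rpower x (- c).
Proof.
  intros Hx Hxy Hc. rewrite !Rpower_Ropp.
  apply Rinv_le_contravar; [apply exp_pos|]. now apply Rle_Rpower_l.
Qed.

(** The majorant [2 * eta * v0 * n - w n] adds the variation due to [h], with [2 * eta] from
    [cis_lipschitz], to that of the decreasing weight. Its final [- w] cancels the boundary term of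
    the summation by parts, leaving the first weight, at most [v0]. *)
Lemma weighted_sum_bound (G : nat -> R) (h w : nat -> R) (V v0 eta : R) (p m : nat) :
  0 <= V -> 0 <= eta ->
  (forall j, (j <= S m)%nat -> Cmod (csum (fun n => cis (G n)) p j) <= V) ->
  (forall j, (j <= m)%nat -> 0 <= w (p + j)%nat <= v0) ->
  (forall j, (j < m)%nat -> w (S (p + j)) <= w (p + j)%nat) ->
  (forall j, (j < m)%nat -> Rabs (h (S (p + j)) - h (p + j)%nat) <= eta) ->
  Cmod (csum (fun n => Cmult (cis (G n)) (Cmult (RtoC (w n)) (cis (h n)))) p (S m))
    <= V * v0 * (1 + 2 * eta * INR m).
Proof.
  intros HV Heta HA Hw Hdec Hh.
  eapply Rle_trans.
  { apply (abel_summation (fun n => cis (G n)) (fun n => Cmult (RtoC (w n)) (cis (h n)))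
      (fun n => 2 * eta * v0 * INR n - w n) V p m HA).
    intros j Hj.
    replace (Cminus (Cmult (RtoC (w (S (p + j)))) (cis (h (S (p + j)))))
       (Cmult (RtoC (w (p + j)%nat)) (cis (h (p + j)%nat))))
      with (Cplus (Cmult (RtoC (w (S (p + j))))
                     (Cminus (cis (h (S (p + j)))) (cis (h (p + j)%nat))))
        (Cmult (RtoC (w (S (p + j)) - w (p + j)%nat)) (cis (h (p + j)%nat))))
      by (rewrite RtoC_minus; ring).
    eapply Rle_trans; [apply Cmod_triangle|].
    rewrite !Cmod_mult, !Cmod_R, Cmod_cis.
    assert (L := cis_lipschitz (h (S (p + j))) (h (p + j)%nat)).
    specialize (Hh j Hj). specialize (Hdec j Hj).
    assert (W0 := Hw (S j) ltac:(lia)). rewrite <- plus_n_Sm in W0.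
    rewrite (Rabs_pos_eq (w (S (p + j)))) by lra.
    rewrite Rabs_left1 by lra. rewrite S_INR.
    assert (w (S (p + j)) * Cmod (Cminus (cis (h (S (p + j)))) (cis (h (p + j)%nat)))
              <= v0 * (2 * eta))
      by (apply Rmult_le_compat; try lra; apply Cmod_ge_0).
    lra. }
  rewrite Cmod_mult, Cmod_R, Cmod_cis, plus_INR.
  assert (W0 := Hw m (le_n _)). assert (W1 := Hw 0%nat ltac:(lia)). rewrite Nat.add_0_r in W1.
  rewrite Rabs_pos_eq by lra. rewrite (Rmult_assoc V v0).
  apply Rmult_le_compat_l; [exact HV|].
  lra.
Qed.

Lemma summand_factor (g : R -> R) (h : nat -> R) (mu alpha : R) (n : nat) :
  summand g h mu alpha n =
    Cmult (cis (mu * g (INR n))) (Cmult (RtoC (Rpower (Derive g (INR n)) (- alpha))) (cis (h n))).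
Proof.
  unfold summand, cis, Cmult, RtoC. cbn [fst snd].
  rewrite Rpower_Ropp, cos_plus, sin_plus. unfold Rdiv. f_equal; ring.
Qed.

Theorem theorem5p3 :
  forall F1 F2 E1 E2 al2 be1 be2 mu1 mu2 C1 C2 : R,
    0 < F1 -> 0 < be1 -> 0 < mu1 -> 0 < C1 ->
    exists K : R, 0 < K /\
    forall F E alpha beta mu Cst : R,
      F1 <= F <= F2 -> E1 <= E <= E2 -> 0 <= alpha <= al2 ->
      be1 <= beta <= be2 -> mu1 <= mu <= mu2 -> C1 <= Cst <= C2 ->
      forall g : R -> R, is_phase_of_zeta F E g ->
      forall h : nat -> R,
      exists L0 : nat, forall l : nat, (L0 <= l)%nat ->
        (forall n : nat, xl F l <= INR n <= xl F (S l) ->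
           Rabs (h (S n) - h n) <= Cst * Rpower (INR n) (- beta)) ->
        forall a b : R, xl F l <= a -> a < b -> b <= xl F (S l) ->
          Cmod (window_sum g h mu alpha a b)
            <= K * Rpower (INR l) (- alpha + 1 / 2)
                 * (1 + Rpower (INR l) (1 - 2 * beta)).
Proof.
  intros F1 F2 E1 E2 al2 be1 be2 mu1 mu2 C1 C2 HF1 Hbe1 Hmu1 HC1.
  (* Here [24 / (mu1 * F1)] is the worst case of [24 / (mu * F)]. Absolute values are taken because
     [K] must be positive before any parameter is given, and the ranges might be empty. *)
  set (K1 := (17 * Rabs mu2 + 3) * (17 * sqrt (24 / (mu1 * F1)))).
  (* Bounds [F^beta] uniformly; the base is at least 1, so the power increases with the exponent. *)
  set (M := Rpower (1 + Rabs F2) be2).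
  assert (Amu := Rabs_pos mu2). assert (AC := Rabs_pos C2). assert (AF := Rabs_pos F2).
  assert (HmF : 0 < mu1 * F1) by (apply Rmult_lt_0_compat; lra).
  assert (HK1 : 0 < K1).
  { unfold K1. apply Rmult_lt_0_compat; [lra|]. apply Rmult_lt_0_compat; [lra|].
    apply sqrt_lt_R0, Rdiv_lt_0_compat; lra. }
  assert (HM : 0 < M) by apply exp_pos.
  assert (HK2 : 0 <= 66 * (Rabs C2 * M) / F1).
  { apply Rdiv_le_0_compat; [|lra]. apply Rmult_le_pos; [lra|]. apply Rmult_le_pos; lra. }
  exists (K1 * (1 + 66 * (Rabs C2 * M) / F1)). split; [apply Rmult_lt_0_compat; lra|].
  intros F E alpha beta mu Cst HF HE Hal Hbe Hmu HC g Hg h.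
  destruct (window_asymptotics F E g ltac:(lra) Hg) as [g1 [g2 [L0 [HL0 HW]]]].
  (* Adding [mu * F] to the threshold ensures [mu * F <= 24 * l], the condition under which the
     second derivative test has [lam <= 1]. *)
  destruct (nfloor_ex (L0 + mu * F)) as [N [_ HN]].
  { assert (0 < mu * F) by (apply Rmult_lt_0_compat; lra). lra. }
  exists (S N). intros l Hl Hh a b Ha Hab Hb.
  assert (HmuF : 0 < mu * F) by (apply Rmult_lt_0_compat; lra).
  apply le_INR in Hl. rewrite S_INR in Hl.
  destruct (HW l ltac:(lra)) as [HFl [Hlen HD]].
  set (L := INR l) in *.
  assert (HLpos : 0 < L) by lra.
  set (V := K1 * Rpower L (1 / 2)).
  (* On the window [n >= l^2 / F], so [n^(- beta) <= F^beta * l^(- 2 beta)]. *)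
  set (eta := Rabs C2 * (M * Rpower L (- (2 * beta)))).
  assert (Heta : 0 <= eta).
  { unfold eta. apply Rmult_le_pos; [lra|]. apply Rmult_le_pos; [lra|left; apply exp_pos]. }
  assert (HV : 0 <= V).
  { unfold V. apply Rmult_le_pos; [lra|left; apply exp_pos]. }
  unfold window_sum.
  destruct (window_sum_block (summand g h mu alpha) a b (Z.to_nat (up b))) as [p [m [Heq [Hin _]]]].
  rewrite Heq. clear Heq.
  assert (HR1 : 0 < Rpower L (- alpha + 1 / 2)) by apply exp_pos.
  assert (HR2 : 0 < Rpower L (1 - 2 * beta)) by apply exp_pos.
  destruct m as [|m].
  { simpl. rewrite Cmod_0. apply Rmult_le_pos; [|lra].
    apply Rmult_le_pos; [|lra]. apply Rmult_le_pos; lra. }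
  assert (Hwin : forall j, (j <= m)%nat -> xl F l <= INR (p + j) <= xl F (S l))
    by (intros j Hj; specialize (Hin j ltac:(lia)); lra).
  assert (Hg1 : forall j, (j <= m)%nat -> Derive g (INR (p + j)) = g1 (INR (p + j))).
  { intros j Hj. apply is_derive_unique. apply HD. specialize (Hwin j Hj). lra. }
  set (w := fun n => Rpower (g1 (INR n)) (- alpha)).
  rewrite (csum_ext _ (fun n => Cmult (cis (mu * g (INR n))) (Cmult (RtoC (w n)) (cis (h n))))).
  2:{ intros j Hj. rewrite summand_factor, Hg1 by lia. easy. }
  assert (HVsum : forall j, (j <= S m)%nat ->
    Cmod (csum (fun n => cis (mu * g (INR n))) p j) <= V).
  { intros j Hj. eapply Rle_trans.
    - apply (phase_sum_bound g g1 g2 F L mu (xl F l) (xl F (S l)) p m); auto; try lra.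
      + intros x Hx. destruct (HD x Hx) as [_ H]. exact H.
      + generalize (Hwin 0%nat ltac:(lia)). rewrite Nat.add_0_r. lra.
      + apply Hwin. lia.
    - unfold V, K1. rewrite Rmult_assoc. apply Rmult_le_compat.
      + lra.
      + apply Rdiv_le_0_compat; [lra|]. apply sqrt_lt_R0, Rdiv_lt_0_compat; lra.
      + generalize (Rle_abs mu2). lra.
      + assert (Es : Rpower L (1 / 2) = sqrt L)
          by (rewrite <- Rpower_sqrt by lra; f_equal; lra).
        rewrite Es, Rmult_assoc. unfold Rdiv at 1. apply Rmult_le_compat_l; [lra|].
        rewrite <- sqrt_inv, <- sqrt_mult_alt
          by (apply Rlt_le, Rdiv_lt_0_compat; lra).
        apply sqrt_le_1_alt.
        replace (/ (mu * F / (24 * L))) with (24 * L * / (mu * F)) by (field; lra).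
        replace (24 / (mu1 * F1) * L) with (24 * L * / (mu1 * F1)) by (field; lra).
        apply Rmult_le_compat_l; [lra|]. apply Rinv_le_contravar; [lra|].
        apply Rmult_le_compat; lra. }
  eapply Rle_trans.
  { apply (weighted_sum_bound (fun n => mu * g (INR n)) h w V (Rpower L (- alpha)) eta p m);
      auto.
    - intros j Hj. split; [left; apply exp_pos|]. unfold w.
      specialize (Hwin j Hj). apply Rpower_neg_le; [exact HLpos| |lra].
      apply HD. lra.
    - intros j Hj. assert (W0 := Hwin j ltac:(lia)). assert (W1 := Hwin (S j) ltac:(lia)).
      rewrite <- plus_n_Sm in W1. rewrite S_INR in W1. unfold w. rewrite S_INR.
      set (x := INR (p + j)) in *.
      assert (G0 : L <= g1 x) by (apply HD; lra).
      apply Rpower_neg_le; [lra| |lra].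
      assert (D := MVT_bounds g1 g2 x (x + 1) (F / (24 * L)) (F / (2 * L)) ltac:(lra)).
      assert (0 < F / (24 * L)) by (apply Rdiv_lt_0_compat; lra).
      assert (F / (24 * L) * (x + 1 - x) <= g1 (x + 1) - g1 x <= F / (2 * L) * (x + 1 - x))
        by (apply D; intros y Hy; apply HD; lra).
      lra.
    - intros j Hj. assert (W0 := Hwin j ltac:(lia)).
      eapply Rle_trans; [apply Hh; exact W0|]. unfold eta.
      apply Rmult_le_compat; [lra|left; apply exp_pos| |].
      + generalize (Rle_abs C2). lra.
      + assert (HL2 : 0 < L ^ 2 / F) by (apply Rdiv_lt_0_compat; [apply pow_lt|]; lra).
        apply Rle_trans with (Rpower (L ^ 2 / F) (- beta)).
        { apply Rpower_neg_le; [exact HL2| |lra]. apply HD. lra. }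
        unfold Rdiv. rewrite <- Rpower_mult_distr
          by (try apply Rinv_0_lt_compat; try apply pow_lt; lra).
        rewrite Rmult_comm.
        replace (Rpower (L ^ 2) (- beta)) with (Rpower L (- (2 * beta))).
        2:{ rewrite <- (Rpower_pow 2 L) by lra. rewrite Rpower_mult. f_equal. cbn [INR]. ring. }
        apply Rmult_le_compat_r; [left; apply exp_pos|].
        replace (Rpower (/ F) (- beta)) with (Rpower F beta)
          by (unfold Rpower; rewrite ln_Rinv by lra; f_equal; ring).
        apply Rle_trans with (Rpower (1 + Rabs F2) beta).
        * apply Rle_Rpower_l; [lra|]. generalize (Rle_abs F2). lra.
        * apply Rle_Rpower; lra. }
  assert (HX : L * Rpower L (- (2 * beta)) = Rpower L (1 - 2 * beta)).
  { rewrite <- (Rpower_1 L) at 1 by lra. rewrite <- Rpower_plus. easy. }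
  assert (Hm : INR m <= 33 * L / F1).
  { assert (W0 := Hwin 0%nat ltac:(lia)). assert (W1 := Hwin m (le_n _)).
    rewrite Nat.add_0_r in W0. rewrite plus_INR in W1.
    apply Rle_trans with (33 * L / F); [lra|].
    apply Rmult_le_compat_l; [lra|]. apply Rinv_le_contravar; lra. }
  (* About [33 l / F1] steps of size [l^(- 2 beta)] produce the power [l^(1 - 2 beta)]; the constant
     66 is [2 * 33]. *)
  assert (Hem : 2 * eta * INR m <= 66 * (Rabs C2 * M) / F1 * Rpower L (1 - 2 * beta)).
  { apply Rle_trans with (2 * eta * (33 * L / F1)); [apply Rmult_le_compat_l; lra|].
    right. rewrite <- HX. unfold eta. field. lra. }
  unfold V. rewrite (Rmult_assoc K1), <- Rpower_plus, (Rplus_comm (1 / 2)).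
  set (X := Rpower L (1 - 2 * beta)) in *. set (Y := Rpower L (- alpha + 1 / 2)) in *.
  set (c := 66 * (Rabs C2 * M) / F1) in *.
  replace (K1 * (1 + c) * Y * (1 + X)) with (K1 * Y * ((1 + c) * (1 + X))) by ring.
  apply Rmult_le_compat_l; [apply Rmult_le_pos; lra|].
  assert (0 <= c * X) by (apply Rmult_le_pos; lra). lra.
Qed.
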